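(* Let $(P,\delta)$ be an operad of bigraded differential graded $R$-modules (vertical differential only), let $A=A_{*,*}$ and $C=C_{*,*}$ be bigraded dg algebras over $P$, and let $$0\to A\xrightarrow{\,i\,}A\xrightarrow{\,j\,}C\to 0$$ be a short exact sequence of chain complexes, with $i$ of bidegree $(1,0)$ and $j$ of bidegree $(0,0)$, such that for all $\ell\ge 1$ and all $\theta\in P(\ell)$, $x_1,\dots,x_\ell\in A$: (i) $j(\theta(x_1,\dots,x_\ell))=\theta(j(x_1),\dots,j(x_\ell))$; (ii) $i(\theta(x_1,\dots,x_\ell))=\theta(x_1,\dots,i(x_h),\dots,x_\ell)$ for every $1\le h\le \ell$. Then the spectral sequence $\{E^r,d^{(r)}\}_{r\ge1}$ arising from this short exact sequence inherits the operad algebra structure at all levels: for every $r\ge 1$, $E^r$ is an algebra over the homology operad $H(P,\delta)$ (with zero differential), where $E^1=H(C)$ carries the action induced from the $P$-action on $C$ and the action on $E^{r+1}=H(E^r,d^{(r)})$ is the one induced from that on $E^r$; and $d^{(r)}$ satisfies the Leibniz rule $$d^{(r)}\big(\theta(x_1,\dots,x_\ell)\big)=\sum_{h=1}^{\ell}(-1)^{|\theta|+|x_1|+\cdots+|x_{h-1}|}\,\theta(x_1,\dots,d^{(r)}(x_h),\dots,x_\ell)$$ for all $\theta\in H(P(\ell),\delta)$ and $x_1,\dots,x_\ell\in E^r$.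
   Context: $R$ is a commutative ground ring; $\otimes=\otimes_R$. A (dg) operad $P=\{P(n)\}_{n\ge1}$ is a sequence of dg $R$-modules $(P(n),\delta)$ with $\Sigma_n$-actions and unital, associative, equivariant composition maps $P(k)\otimes P(j_1)\otimes\cdots\otimes P(j_k)\to P(j_1+\cdots+j_k)$ of dg modules. A $P$-algebra is a dg module $(A,d)$ with associative and equivariant dg-module maps $P(k)\otimes A^{\otimes k}\to A$, written $(\theta,x_1,\dots,x_k)\mapsto\theta(x_1,\dots,x_k)$; thus $$d(\theta(x_1,\dots,x_k))=(\delta\theta)(x_1,\dots,x_k)+\sum_{h}(-1)^{|\theta|+|x_1|+\cdots+|x_{h-1}|}\theta(x_1,\dots,d x_h,\dots,x_k).$$ In the bigraded setting, differentials are vertical (bidegree $(0,-1)$), $|\cdot|$ denotes the vertical (second) degree, and the structure maps preserve the bigrading. If $(A,d)$ is a $(P,\delta)$-algebra then $H(A,d)$ is an $H(P,\delta)$-algebra via $[\theta]([x_1],\dots,[x_k])=[\theta(x_1,\dots,x_k)]$. The spectral sequence: the long exact homology sequence gives the exact couple $D^1=H(A)$, $E^1=H(C)$, with maps $i:D^1\to D^1$ and $j:D^1\to E^1$ induced by $i,j$, and $k:E^1\to D^1$ the connecting homomorphism. Successive derived couples $\langle E^r,D^r,i^{(r)},j^{(r)},k^{(r)}\rangle$ are given by $E^{r+1}=H(E^r,d^{(r)})$ with $d^{(r)}=j^{(r)}k^{(r)}$, $D^{r+1}=i^{(r)}(D^r)$, with $i^{(r)},k^{(r)}$ induced by $i,k$,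 and $j^{(r)}(a)=[j(i^{-(r-1)}(a))]$, where $i^{-(r-1)}(a)$ is any preimage of $a$ under $i^{r-1}$. *)

(* Defs.v *)
From Stdlib Require Eqdep_dec.
From HB Require Import structures.
From mathcomp Require Import all_boot all_order all_algebra all_fingroup.
From mathcomp Require Import generic_quotient ring_quotient.
From mathcomp Require Import boolp.

Set Implicit Arguments.
Unset Strict Implicit.
Unset Printing Implicit Defensive.

Import GRing.Theory.
Local Open Scope ring_scope.

Record submodule (R : comPzRingType) (M : lmodType R) := Submodule {
  sm_pred :> {pred M};
  sm_closed : submod_closed sm_pred }.

Section Modules.
Variable R : comPzRingType.

HB.instance Definition _ (M : lmodType R) (S : submodule M) :=
  GRing.isSubmodClosed.Build R M (sm_pred S) (sm_closed S).
HB.instance Definition _ (M : lmodType R) (S : submodule M) :=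
  GRing.isZmodClosed.Build M (sm_pred S) (GRing.submod_closedB (sm_closed S)).

Variables (M : lmodType R) (S : submodule M).

Definition subm := {x : M | x \in S}.
HB.instance Definition _ := SubType.on subm.
HB.instance Definition _ := [Choice of subm by <:].
HB.instance Definition _ := [SubChoice_isSubLmodule of subm by <:].

Lemma subm_valP a (x y : subm) : val (a *: x + y) = a *: val x + val y.
Proof. by rewrite linearP. Qed.

Definition quom : Type := Quotient.quot S.
HB.instance Definition _ := EqQuotient.on quom.
HB.instance Definition _ := GRing.Zmodule.on quom.

Definition qcl (x : M) : quom := (\pi_(Quotient.quot S) x)%qT.

Lemma qcl_eq x y : (qcl x = qcl y) <-> (x - y \in S).
Proof.
by rewrite Quotient.idealrBE; split=> [h|/eqP //]; apply/eqP.
Qed.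

Lemma qcl_surj q : exists x, q = qcl x.
Proof. by exists (repr q); rewrite /qcl reprK. Qed.

Lemma qcl_is_zmod : zmod_morphism qcl.
Proof. by move=> x y; rewrite /qcl raddfB. Qed.
HB.instance Definition _ := GRing.isZmodMorphism.Build M quom qcl qcl_is_zmod.

Definition qscale (a : R) (q : quom) : quom := qcl (a *: repr q).

Lemma qscaleE a x : qscale a (qcl x) = qcl (a *: x).
Proof.
apply/qcl_eq; rewrite -scalerBr; apply: rpredZ.
by apply/qcl_eq; rewrite /qcl reprK.
Qed.

Lemma qscaleA a b q : qscale a (qscale b q) = qscale (a * b) q.
Proof. by have [x ->] := qcl_surj q; rewrite !qscaleE scalerA. Qed.
Lemma qscale1 : left_id 1 qscale.
Proof. by move=> q; have [x ->] := qcl_surj q; rewrite !qscaleE scale1r. Qed.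
Lemma qscaleDr : right_distributive qscale +%R.
Proof.
move=> a q q'; have [x ->] := qcl_surj q; have [y ->] := qcl_surj q'.
by rewrite -raddfD !qscaleE scalerDr raddfD.
Qed.
Lemma qscaleDl q : {morph qscale^~ q : a b / a + b}.
Proof.
by move=> a b; have [x ->] := qcl_surj q; rewrite !qscaleE scalerDl raddfD.
Qed.
HB.instance Definition _ :=
  GRing.Zmodule_isLmodule.Build R quom qscaleA qscale1 qscaleDr qscaleDl.

Lemma qcl_is_scalable : scalable qcl.
Proof. by move=> a x; rewrite -qscaleE. Qed.
HB.instance Definition _ :=
  GRing.isScalable.Build R M quom *:%R qcl qcl_is_scalable.

End Modules.

Section GraphLinear.
Variables (R : comPzRingType) (M N : lmodType R) (G : M -> N -> Prop).

(* G is the graph of a linear map, namely [graph_lin] below. *)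
Record linear_graph : Prop := LinearGraph {
  lg_lin : forall a x y x' y',
    G x y -> G x' y' -> G (a *: x + x') (a *: y + y');
  lg_total : forall x, exists y, G x y;
  lg_zero : forall y, G 0 y -> y = 0 }.

Hypothesis HG : linear_graph.

Definition graph_fun (x : M) : N := projT1 (cid (lg_total HG x)).

Lemma graph_funP x : G x (graph_fun x).
Proof. by rewrite /graph_fun; case: cid. Qed.

Lemma graph_fun_eq x y : G x y -> graph_fun x = y.
Proof.
move=> h; apply/eqP; rewrite -subr_eq0; apply/eqP/(lg_zero HG).
have := lg_lin HG (-1) h (graph_funP x).
by rewrite !scaleN1r addNr addrC.
Qed.

Lemma graph_fun_is_linear : linear graph_fun.
Proof.
by move=> a x y; apply: graph_fun_eq; apply: (lg_lin HG); exact: graph_funP.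
Qed.
HB.instance Definition _ :=
  GRing.isLinear.Build R M N *:%R graph_fun graph_fun_is_linear.

Definition graph_lin : {linear M -> N} := graph_fun.

End GraphLinear.

(* (horizontal, vertical) *)
Definition bideg : Type := (int * int)%type.
HB.instance Definition _ := GRing.Zmodule.on bideg.

(* A bigraded module is encoded by its total module, the direct sum of the
   pieces M_{p,q}, together with the projections onto the pieces.  This keeps
   maps of nonzero bidegree free of index casts. *)
Record bigraded (R : comPzRingType) := Bigraded {
  bg_mod :> lmodType R;
  proj : bideg -> {linear bg_mod -> bg_mod};
  proj_proj : forall a b x,
    proj a (proj b x) = if a == b then proj b x else 0;
  proj_sum : forall x, exists s : seq bideg,
    uniq s /\ x = \sum_(a <- s) proj a x }.
Arguments proj {R _} _.

Section BigradedTheory.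
Variable R : comPzRingType.

Definition homog (M : bigraded R) (a : bideg) (x : M) : Prop := proj a x = x.

Definition has_bidegree (M N : bigraded R) (b : bideg) (f : M -> N) : Prop :=
  forall a x, homog a x -> homog (a + b) (f x).

Lemma homog_proj (M : bigraded R) a (x : M) : homog a (proj a x).
Proof. by rewrite /homog proj_proj eqxx. Qed.

Lemma homog_proj_eq (M : bigraded R) a b (x : M) :
  homog a x -> proj b x = if b == a then x else 0.
Proof. by rewrite /homog => h; have := proj_proj b a x; rewrite h. Qed.

Lemma proj_inj (M : bigraded R) (x y : M) :
  (forall a, proj a x = proj a y) -> x = y.
Proof.
move=> h; apply/eqP; rewrite -subr_eq0; apply/eqP.
have [s [_ ->]] := proj_sum (x - y).
by rewrite big1 // => a _; rewrite raddfB /= h subrr.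
Qed.

Lemma bidegree_proj (M N : bigraded R) b (f : {linear M -> N}) :
  has_bidegree b f -> forall a x, f (proj a x) = proj (a + b) (f x).
Proof.
move=> hf a x; have [s [_ ->]] := proj_sum x.
rewrite !raddf_sum /=; apply: eq_bigr => c _.
rewrite (homog_proj_eq _ (hf _ _ (homog_proj c x))) (inj_eq (addIr b)).
by rewrite proj_proj; case: eqP => // _; rewrite raddf0.
Qed.

Lemma homog_bidegree (M N : bigraded R) b (f : M -> N) :
  (forall a x, f (proj a x) = proj (a + b) (f x)) -> has_bidegree b f.
Proof. by move=> h a x hx; rewrite /homog -h hx. Qed.

Definition graded_sub (M : bigraded R) (S : submodule M) : Prop :=
  forall a x, x \in S -> proj a x \in S.

Section Sub.
Variables (M : bigraded R) (S : submodule M) (gS : graded_sub S).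

Definition sub_proj (a : bideg) (x : subm S) : subm S :=
  exist _ (proj a (val x)) (gS a (valP x)).

Lemma sub_proj_is_linear a : linear (sub_proj a).
Proof. by move=> c x y; apply: val_inj; rewrite /= linearP. Qed.
HB.instance Definition _ a := GRing.isLinear.Build R (subm S) (subm S) *:%R
  (sub_proj a) (sub_proj_is_linear a).

Lemma sub_proj_proj a b x :
  sub_proj a (sub_proj b x) = if a == b then sub_proj b x else 0.
Proof. by apply: val_inj; rewrite /= proj_proj; case: eqP. Qed.

Lemma sub_proj_sum x : exists s : seq bideg,
  uniq s /\ x = \sum_(a <- s) sub_proj a x.
Proof.
have [s [us e]] := proj_sum (val x); exists s; split=> //.
by apply: val_inj; rewrite raddf_sum.
Qed.

Definition sub_bigraded : bigraded R :=
  @Bigraded R (subm S) (fun a => sub_proj a) sub_proj_proj sub_proj_sum.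

End Sub.

Section Quo.
Variables (M : bigraded R) (S : submodule M) (gS : graded_sub S).

Lemma quo_proj_graph a :
  linear_graph (fun q q' : quom S =>
    exists x, q = qcl S x /\ q' = qcl S (proj a x)).
Proof.
split=> [c q q1 r r1 [x [-> ->]] [y [-> ->]]|q|q].
- by exists (c *: x + y); rewrite !linearP.
- by have [x ->] := qcl_surj q; exists (qcl S (proj a x)), x.
- case=> x [h ->]; rewrite -(raddf0 (qcl S)); apply/qcl_eq; rewrite subr0.
  apply: gS; rewrite -[x]subr0; apply/qcl_eq.
  by rewrite -h raddf0.
Qed.

Definition quo_proj a : {linear quom S -> quom S} :=
  graph_lin (quo_proj_graph a).

Lemma quo_projE a x : quo_proj a (qcl S x) = qcl S (proj a x).
Proof. by apply: graph_fun_eq; exists x. Qed.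

Lemma quo_proj_proj a b q :
  quo_proj a (quo_proj b q) = if a == b then quo_proj b q else 0.
Proof.
have [x ->] := qcl_surj q; rewrite !quo_projE proj_proj.
by case: eqP => // _; rewrite raddf0.
Qed.

Lemma quo_proj_sum q : exists s : seq bideg,
  uniq s /\ q = \sum_(a <- s) quo_proj a q.
Proof.
have [x ->] := qcl_surj q; have [s [us e]] := proj_sum x; exists s; split=> //.
rewrite {1}e raddf_sum; apply: eq_bigr => a _; exact/esym/quo_projE.
Qed.

Definition quo_bigraded : bigraded R :=
  @Bigraded R (quom S) quo_proj quo_proj_proj quo_proj_sum.

End Quo.

End BigradedTheory.

Record diffmod (R : comPzRingType) (b : bideg) := Diffmod {
  dm_bg :> bigraded R;
  diff : {linear dm_bg -> dm_bg};
  diff_bideg : has_bidegree b diff;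
  diff_diff : forall x, diff (diff x) = 0 }.
Arguments diff {R b _}.

Definition vdeg : bideg := (0, -1).
Notation dgmod R := (diffmod R vdeg).

Section ZeroDiff.
Variables (R : comPzRingType) (b : bideg) (M : bigraded R).

Definition zero_map (x : M) : M := 0.
Lemma zero_map_is_linear : linear zero_map.
Proof. by move=> a x y; rewrite /zero_map scaler0 addr0. Qed.
HB.instance Definition _ :=
  GRing.isLinear.Build R M M *:%R zero_map zero_map_is_linear.

Lemma zero_map_bideg : has_bidegree b zero_map.
Proof. by move=> a x _; rewrite /homog raddf0. Qed.

Definition zero_diffmod : diffmod R b :=
  @Diffmod R b M zero_map zero_map_bideg (fun x => erefl).
End ZeroDiff.

Section Homology.
Variables (R : comPzRingType) (b : bideg) (M : diffmod R b).

Lemma cycles_closed : submod_closed [pred x : M | diff x == 0].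
Proof.
split=> [|a x y]; rewrite !inE ?raddf0 // => /eqP hx /eqP hy.
by rewrite linearP hx hy scaler0 addr0.
Qed.
Definition cycles : submodule M := Submodule cycles_closed.

Lemma cyclesP (x : M) : reflect (diff x = 0) (x \in cycles).
Proof. exact: eqP. Qed.

Lemma cycles_graded : graded_sub cycles.
Proof.
move=> a x /cyclesP h; apply/cyclesP.
by rewrite (bidegree_proj (@diff_bideg R b M)) h raddf0.
Qed.

Definition cycle_bg : bigraded R := sub_bigraded cycles_graded.

Lemma boundaries_closed :
  submod_closed [pred z : cycle_bg | `[< exists y : M, val z = diff y >]].
Proof.
split=> [|a x y]; rewrite !inE.
  by apply/asboolP; exists 0; rewrite !raddf0.
move=> /asboolP[u hu] /asboolP[v hv]; apply/asboolP; exists (a *: u + v).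
by rewrite !linearP /= hu hv.
Qed.
Definition boundaries : submodule cycle_bg := Submodule boundaries_closed.

Lemma boundaries_graded : graded_sub boundaries.
Proof.
move=> a x /asboolP[y hy]; apply/asboolP; exists (proj (a - b) y).
by rewrite (bidegree_proj (@diff_bideg R b M)) subrK -hy.
Qed.

Definition homology : bigraded R := quo_bigraded boundaries_graded.

(* [represents x h]: x is a cycle and its homology class is h. *)
Definition represents (x : M) (h : homology) : Prop :=
  exists z : subm cycles, val z = x /\ h = qcl boundaries z.

Lemma repr_cycle x h : represents x h -> diff x = 0.
Proof. by case=> z [<- _]; apply/cyclesP; exact: valP. Qed.

Lemma repr_ex h : exists x, represents x h.
Proof. by have [z ->] := qcl_surj h; exists (val z), z. Qed.

Lemma cycle_repr x : diff x = 0 -> exists h, represents x h.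
Proof.
by move=> /cyclesP hx; exists (qcl boundaries (exist _ x hx)), (exist _ x hx).
Qed.

Lemma repr_lin a x h x' h' : represents x h -> represents x' h' ->
  represents (a *: x + x') (a *: h + h').
Proof.
case=> z [<- ->] [z' [<- ->]]; exists (a *: z + z').
by rewrite !linearP.
Qed.

Lemma repr0P x : represents x 0 <-> exists y, x = diff y.
Proof.
split=> [[z [<- h]]|[y ->]].
  have /asboolP : z \in boundaries.
    by rewrite -[z]subr0; apply/qcl_eq; rewrite -h raddf0.
  by case=> y ->; exists y.
have hy : diff y \in cycles by apply/cyclesP; exact: diff_diff.
exists (exist _ (diff y) hy); split=> //.
apply/esym; rewrite -(raddf0 (qcl boundaries)); apply/qcl_eq; rewrite subr0.
by apply/asboolP; exists y.
Qed.

Lemma repr_proj a x h : represents x h -> represents (proj a x) (proj a h).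
Proof.
by case=> z [<- ->]; exists (proj a (z : cycle_bg)); split => //; exact: quo_projE.
Qed.

Lemma repr_uniq x h h' : represents x h -> represents x h' -> h = h'.
Proof.
move=> H H'; case: H H' => z [<- ->] [z' [e ->]].
by congr qcl; exact/esym/val_inj.
Qed.

Lemma repr_diff x h x' h' : represents x h -> represents x' h' ->
  h = h' <-> exists y, x - x' = diff y.
Proof.
move=> H H'; have := repr_lin (-1) H' H; rewrite !scaleN1r ![- _ + _]addrC => Hd.
split=> [e|h0]; first by move: Hd; rewrite e subrr => /repr0P.
by apply/eqP; rewrite -subr_eq0; apply/eqP/(repr_uniq Hd)/repr0P.
Qed.

Lemma repr_homog a h : homog a h -> exists2 x, homog a x & represents x h.
Proof.
move=> hh; have [x hx] := repr_ex h; exists (proj a x); first exact: homog_proj.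
by rewrite -hh; exact: repr_proj.
Qed.

Definition hrep (h : homology) : M := projT1 (cid (repr_ex h)).
Lemma hrepP h : represents (hrep h) h.
Proof. by rewrite /hrep; case: cid. Qed.

End Homology.

Section HomologyMap.
Variables (R : comPzRingType) (b b' : bideg) (M : diffmod R b)
  (N : diffmod R b') (f : {linear M -> N}).
Hypothesis fd : forall x, f (diff x) = diff (f x).

Lemma hmap_graph : linear_graph (fun (h : homology M) (h' : homology N) =>
  exists x, represents x h /\ represents (f x) h').
Proof.
split=> [a x y x' y' [u [h1 h2]] [v [h3 h4]]|x|y [x [/repr0P[u ->]]]].
- by exists (a *: u + v); rewrite linearP; split; apply: repr_lin.
- have [u hu] := repr_ex x.
  have [|y hy] := @cycle_repr _ _ N (f u).
    by rewrite -fd (repr_cycle hu) raddf0.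
  by exists y, u.
- by rewrite fd => h; apply: (repr_uniq h); apply/repr0P; exists (f u).
Qed.

Definition hmap : {linear homology M -> homology N} := graph_lin hmap_graph.

Lemma hmapP x h : represents x h -> represents (f x) (hmap h).
Proof.
move=> hx.
have [|h' hh'] := @cycle_repr _ _ N (f x).
  by rewrite -fd (repr_cycle hx) raddf0.
suff -> : hmap h = h' by [].
by apply: graph_fun_eq; exists x.
Qed.

Lemma hmap_bideg c : has_bidegree c f -> has_bidegree c hmap.
Proof.
move=> hf a h /repr_homog[x hx xh]; have H := hmapP xh.
have := repr_proj (a + c) H; rewrite (hf _ _ hx) => H'.
exact: repr_uniq H' H.
Qed.

End HomologyMap.

Record exact_couple (R : comPzRingType) := ExactCouple {
  ec_D : bigraded R;
  ec_E : bigraded R;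
  ec_i : {linear ec_D -> ec_D};
  ec_j : {linear ec_D -> ec_E};
  ec_k : {linear ec_E -> ec_D};
  ideg : bideg;
  jdeg : bideg;
  kdeg : bideg;
  ec_i_bideg : has_bidegree ideg ec_i;
  ec_j_bideg : has_bidegree jdeg ec_j;
  ec_k_bideg : has_bidegree kdeg ec_k;
  ec_exact_ij : forall x, ec_j x = 0 <-> exists y, x = ec_i y;
  ec_exact_jk : forall x, ec_k x = 0 <-> exists y, x = ec_j y;
  ec_exact_ki : forall x, ec_i x = 0 <-> exists y, x = ec_k y }.
Arguments ec_i {R _}.
Arguments ec_j {R _}.
Arguments ec_k {R _}.

Section Derived.
Variables (R : comPzRingType) (X : exact_couple R).

Lemma ec_d_bideg :
  has_bidegree (kdeg X + jdeg X) (@ec_j R X \o @ec_k R X).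
Proof. by move=> a x /ec_k_bideg/ec_j_bideg; rewrite addrA. Qed.

Lemma ec_ki0 (x : ec_E X) : ec_i (ec_k x) = 0.
Proof. by apply/ec_exact_ki; exists x. Qed.
Lemma ec_jk0 (x : ec_D X) : ec_k (ec_j x) = 0.
Proof. by apply/ec_exact_jk; exists x. Qed.
Lemma ec_ij0 (x : ec_D X) : ec_j (ec_i x) = 0.
Proof. by apply/ec_exact_ij; exists x. Qed.

Lemma ec_d_d (x : ec_E X) :
  (@ec_j R X \o @ec_k R X) ((@ec_j R X \o @ec_k R X) x) = 0.
Proof. by rewrite /= ec_jk0 raddf0. Qed.

Definition ec_page : diffmod R (kdeg X + jdeg X) :=
  @Diffmod R _ (ec_E X) (@ec_j R X \o @ec_k R X) ec_d_bideg ec_d_d.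

Lemma im_i_closed :
  submod_closed [pred x : ec_D X | `[< exists y, x = ec_i y >]].
Proof.
split=> [|a x y]; rewrite !inE.
  by apply/asboolP; exists 0; rewrite raddf0.
move=> /asboolP[u ->] /asboolP[v ->]; apply/asboolP; exists (a *: u + v).
by rewrite linearP.
Qed.
Definition im_i : submodule (ec_D X) := Submodule im_i_closed.

Lemma im_iP (x : ec_D X) : (exists y, x = ec_i y) <-> (x \in im_i).
Proof. by split=> [h|/asboolP]; first apply/asboolP. Qed.

Lemma im_i_graded : graded_sub im_i.
Proof.
move=> a x /im_iP[y ->]; apply/im_iP; exists (proj (a - ideg X) y).
by rewrite (bidegree_proj (@ec_i_bideg R X)) subrK.
Qed.

Definition der_D : bigraded R := sub_bigraded im_i_graded.
Definition der_mk x (hx : x \in im_i) : der_D := exist _ x hx.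
Definition der_E : bigraded R := homology ec_page.

Definition der_i_fun (x : der_D) : der_D :=
  exist _ (ec_i (val x)) ((im_iP _).1 (ex_intro _ (val x) erefl)).
Lemma der_i_is_linear : linear der_i_fun.
Proof. by move=> a x y; apply: val_inj; rewrite /= linearP. Qed.
HB.instance Definition _ :=
  GRing.isLinear.Build R der_D der_D *:%R der_i_fun der_i_is_linear.
Definition der_i : {linear der_D -> der_D} := der_i_fun.

(* j'(i a) = [j a] *)
Lemma der_j_graph : linear_graph (fun (x : der_D) (h : der_E) =>
  exists a, val x = ec_i a /\ represents (M := ec_page) (ec_j a) h).
Proof.
split=> [a x y x' y' [u [h1 h2]] [v [h3 h4]]|x|y [a [/esym h1 h2]]].
- exists (a *: u + v); rewrite subm_valP h1 h3 !linearP; split=> //.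
  exact: repr_lin.
- have /im_iP[a ha] := valP x.
  have [|h hh] := @cycle_repr _ _ ec_page (ec_j a).
    by rewrite /= ec_jk0 raddf0.
  by exists h, a.
- move/ec_exact_ki: h1 => [e he].
  by apply: (repr_uniq h2); apply/repr0P; exists e; rewrite he.
Qed.
Definition der_j : {linear der_D -> der_E} := graph_lin der_j_graph.

(* k'[e] = k e *)
Lemma der_k_graph : linear_graph (fun (h : der_E) (x : der_D) =>
  exists e, represents (M := ec_page) e h /\ val x = ec_k e).
Proof.
split=> [a x y x' y' [u [h1 h2]] [v [h3 h4]]|h|x [e [/repr0P[y ->] h2]]].
- exists (a *: u + v); split; first exact: repr_lin.
  by rewrite subm_valP h2 h4 linearP.
- have [e he] := repr_ex h.
  have hk : ec_k e \in im_i.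
    by apply/im_iP/ec_exact_ij; exact: repr_cycle he.
  by exists (der_mk hk), e.
- by apply: val_inj; rewrite h2 /= ec_jk0.
Qed.
Definition der_k : {linear der_E -> der_D} := graph_lin der_k_graph.

Lemma der_jP (a : ec_D X) (x : der_D) : val x = ec_i a ->
  represents (M := ec_page) (ec_j a) (der_j x).
Proof.
move=> hx; have [|h hh] := @cycle_repr _ _ ec_page (ec_j a).
  by rewrite /= ec_jk0 raddf0.
by rewrite /der_j /= (graph_fun_eq der_j_graph (y := h)) //; exists a.
Qed.

Lemma der_kP e h : represents (M := ec_page) e h -> val (der_k h) = ec_k e.
Proof.
move=> he; have hk : ec_k e \in im_i.
  by apply/im_iP/ec_exact_ij; exact: repr_cycle he.
rewrite /der_k /= (graph_fun_eq der_k_graph (y := der_mk hk)) //.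
by exists e.
Qed.

Lemma der_i_bideg : has_bidegree (ideg X) der_i.
Proof.
move=> a x hx; apply: val_inj => /=.
by apply: ec_i_bideg; rewrite /homog -{2}hx.
Qed.

Lemma der_j_bideg : has_bidegree (jdeg X - ideg X) der_j.
Proof.
move=> a x hx; have /im_iP[u hu] := valP x.
have hx' : val x = ec_i (proj (a - ideg X) u).
  by rewrite (bidegree_proj (@ec_i_bideg R X)) subrK -hu -{1}hx.
have H := der_jP hx'.
have := repr_proj (a + (jdeg X - ideg X)) H.
have -> : proj (a + (jdeg X - ideg X)) (ec_j (proj (a - ideg X) u)) =
    ec_j (proj (a - ideg X) u).
  by rewrite addrCA addrC; apply: (ec_j_bideg (homog_proj _ _)).
by move=> H'; apply: repr_uniq H' H.
Qed.

Lemma der_k_bideg : has_bidegree (kdeg X) der_k.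
Proof.
move=> a h /repr_homog[e he eh]; apply: val_inj.
rewrite /= -/(der_k h) (der_kP eh); exact: ec_k_bideg.
Qed.

Lemma der_exact_ij x : der_j x = 0 <-> exists y, x = der_i y.
Proof.
have /im_iP[u hu] := valP x; have H := der_jP hu; split=> [h|[y hy]].
  move: H; rewrite h => /repr0P[e /= he].
  have /ec_exact_ij[y hy] : ec_j (u - ec_k e) = 0 by rewrite raddfB /= he subrr.
  have hy' : ec_i y \in im_i by apply/im_iP; exists y.
  exists (der_mk hy'); apply: val_inj => /=.
  by rewrite -hy raddfB /= ec_ki0 subr0.
have /im_iP[v hv] := valP y; apply: (repr_uniq H).
rewrite hy in hu; move: hu => /= /esym hu.
have /ec_exact_ki[e he] : ec_i (u - val y) = 0 by rewrite raddfB /= hu subrr.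
apply/repr0P; exists e => /=.
by rewrite -he raddfB /= hv ec_ij0 subr0.
Qed.

Lemma der_exact_jk h : der_k h = 0 <-> exists x, h = der_j x.
Proof.
have [e he] := repr_ex h; have hk := der_kP he; split=> [h0|[x hx]].
  move: hk; rewrite h0 => /esym/ec_exact_jk[u hu].
  have hi : ec_i u \in im_i by apply/im_iP; exists u.
  exists (der_mk hi); apply: (repr_uniq he); rewrite hu.
  exact: der_jP.
have /im_iP[u hu] := valP x; have := der_jP hu; rewrite -hx => H.
by apply: val_inj; rewrite (der_kP H) ec_jk0.
Qed.

Lemma der_exact_ki x : der_i x = 0 <-> exists h, x = der_k h.
Proof.
split=> [/(congr1 val) /= /ec_exact_ki[e he]|[h ->]].
  have [|h hh] := @cycle_repr _ _ ec_page e.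
    by apply/ec_exact_ij; have /im_iP[u hu] := valP x; exists u; rewrite -he.
  by exists h; apply: val_inj; rewrite (der_kP hh).
have [e he] := repr_ex h.
by apply: val_inj; rewrite /= -/(der_k h) (der_kP he) ec_ki0.
Qed.

Definition derived_couple : exact_couple R :=
  @ExactCouple R der_D der_E der_i der_j der_k
    (ideg X) (jdeg X - ideg X) (kdeg X)
    der_i_bideg der_j_bideg der_k_bideg
    der_exact_ij der_exact_jk der_exact_ki.

End Derived.

Record short_exact (R : comPzRingType) (A C : dgmod R) := ShortExact {
  se_i : {linear A -> A};
  se_j : {linear A -> C};
  se_i_bideg : has_bidegree (1, 0) se_i;
  se_j_bideg : has_bidegree (0, 0) se_j;
  se_i_diff : forall x, se_i (diff x) = diff (se_i x);
  se_j_diff : forall x, se_j (diff x) = diff (se_j x);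
  se_i_inj : injective se_i;
  se_j_surj : forall c, exists a, se_j a = c;
  se_exact : forall x, se_j x = 0 <-> exists y, x = se_i y }.
Arguments se_i {R A C}.
Arguments se_j {R A C}.

Section SpectralSequence.
Variables (R : comPzRingType) (A C : dgmod R) (S : short_exact A C).

(* The connecting homomorphism: [j a] is sent to [a'] where i a' = d a. *)
Lemma conn_graph : linear_graph (fun (h : homology C) (h' : homology A) =>
  exists a a', [/\ represents (se_j S a) h, se_i S a' = diff a
                 & represents a' h']).
Proof.
split=> [c x y x' y' [u [u' [h1 h2 h3]]] [v [v' [h4 h5 h6]]]|h|h'].
- exists (c *: u + v), (c *: u' + v').
  by rewrite !linearP h2 h5; split=> //; apply: repr_lin.
- have [z hz] := repr_ex h; have [a ha] := se_j_surj S z.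
  have [|a' ha'] := (se_exact S (diff a)).1.
    by rewrite se_j_diff ha (repr_cycle hz).
  have [|h' hh'] := @cycle_repr _ _ A a'.
    by apply: (@se_i_inj _ _ _ S); rewrite se_i_diff -ha' diff_diff raddf0.
  by exists h', a, a'; rewrite ha.
case=> a [a' [/repr0P[c hc] ha' ar]].
have [b hb] := se_j_surj S c.
have [|e he] := (se_exact S (a - diff b)).1.
  by rewrite raddfB /= se_j_diff hb hc subrr.
apply: (repr_uniq ar); apply/repr0P; exists e.
apply: (@se_i_inj _ _ _ S).
by rewrite ha' se_i_diff -he raddfB /= diff_diff subr0.
Qed.
Definition conn : {linear homology C -> homology A} := graph_lin conn_graph.

Lemma connP a a' h : represents (se_j S a) h -> se_i S a' = diff a ->
  represents a' (conn h).
Proof.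
move=> ha haa'; have [|h' hh'] := @cycle_repr _ _ A a'.
  by apply: (@se_i_inj _ _ _ S); rewrite se_i_diff haa' diff_diff raddf0.
rewrite /conn /= (graph_fun_eq conn_graph (y := h')) //.
by exists a, a'.
Qed.

Lemma conn_ex h : exists a a', [/\ represents (se_j S a) h,
  se_i S a' = diff a & represents a' (conn h)].
Proof. exact: (graph_funP conn_graph). Qed.

Lemma conn_bideg : has_bidegree (-1, -1) conn.
Proof.
move=> p h hh; have [a [a' [h1 h2 h3]]] := conn_ex h.
have := repr_proj (p + (-1, -1)) h3.
set x := proj _ a' => Hx.
have E1 : represents (se_j S (proj p a)) h.
  rewrite (bidegree_proj (@se_j_bideg _ _ _ S)) addr0 -hh.
  exact: repr_proj.
have E2 : se_i S x = diff (proj p a).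
  rewrite /x (bidegree_proj (@se_i_bideg _ _ _ S)) h2.
  rewrite (bidegree_proj (@diff_bideg _ _ A)).
  by congr (proj _ _); rewrite -addrA.
exact: repr_uniq Hx (connP E1 E2).
Qed.

Definition hi : {linear homology A -> homology A} := hmap (@se_i_diff _ _ _ S).
Definition hj : {linear homology A -> homology C} := hmap (@se_j_diff _ _ _ S).

Lemma les_exact_ij x : hj x = 0 <-> exists y, x = hi y.
Proof.
have [a ha] := repr_ex x; have hja := hmapP (@se_j_diff _ _ _ S) ha.
split=> [h0|[y hy]].
  move: hja; rewrite -/(hj x) h0 => /repr0P[c hc].
  have [b hb] := se_j_surj S c.
  have [|e he] := (se_exact S (a - diff b)).1.
    by rewrite raddfB /= se_j_diff hb hc subrr.
  have [|y hy] := @cycle_repr _ _ A e.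
    apply: (@se_i_inj _ _ _ S).
    by rewrite se_i_diff -he raddfB /= diff_diff subr0 (repr_cycle ha) raddf0.
  exists y; apply/(repr_diff ha (hmapP (@se_i_diff _ _ _ S) hy)).
  by exists b; rewrite -he opprB addrCA subrr addr0.
have [e he] := repr_ex y; have := hmapP (@se_i_diff _ _ _ S) he.
rewrite -/(hi y) -hy => hx.
have := hmapP (@se_j_diff _ _ _ S) hx; rewrite -/(hj x).
have -> : se_j S (se_i S e) = 0 by apply/se_exact; exists e.
by move=> H; apply: (repr_uniq H); apply/repr0P; exists 0; rewrite raddf0.
Qed.

Lemma les_exact_jk h : conn h = 0 <-> exists x, h = hj x.
Proof.
split=> [h0|[x ->]].
  have [a [a' [h1 h2 h3]]] := conn_ex h.
  move: h3; rewrite h0 => /repr0P[b hb].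
  have E : diff (a - se_i S b) = 0.
    by rewrite raddfB /= -h2 hb se_i_diff subrr.
  have [x hx] := cycle_repr E; exists x.
  apply: (repr_uniq h1); have := hmapP (@se_j_diff _ _ _ S) hx.
  by rewrite raddfB /= [se_j S (se_i S b)](se_exact S _).2 ?subr0; last by exists b.
have [a ha] := repr_ex x; have H := hmapP (@se_j_diff _ _ _ S) ha.
have E : se_i S 0 = diff a by rewrite raddf0 (repr_cycle ha).
apply: (repr_uniq (connP H E)).
by apply/repr0P; exists 0; rewrite raddf0.
Qed.

Lemma les_exact_ki x : hi x = 0 <-> exists h, x = conn h.
Proof.
split=> [h0|[h ->]].
  have [a ha] := repr_ex x; have := hmapP (@se_i_diff _ _ _ S) ha.
  rewrite -/(hi x) h0 => /repr0P[b hb].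
  have [|h hh] := @cycle_repr _ _ C (se_j S b).
    by rewrite -se_j_diff -hb; apply/se_exact; exists a.
  by exists h; apply: (repr_uniq ha); exact: connP hh hb.
have [a [a' [h1 h2 h3]]] := conn_ex h.
apply: (repr_uniq (hmapP (@se_i_diff _ _ _ S) h3)); rewrite h2.
by apply/repr0P; exists a.
Qed.

Definition ses_couple : exact_couple R :=
  @ExactCouple R (homology A) (homology C) hi hj conn (1, 0) (0, 0) (-1, -1)
    (hmap_bideg _ (@se_i_bideg _ _ _ S)) (hmap_bideg _ (@se_j_bideg _ _ _ S))
    conn_bideg les_exact_ij les_exact_jk les_exact_ki.

(* Numbered from 0: [ss_couple n] is the couple (D^{n+1}, E^{n+1}, ...), and
   [ss_page n] is (E^{n+1}, d^{(n+1)}), starting with E^1 = H(C). *)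
Fixpoint ss_couple (n : nat) : exact_couple R :=
  if n is m.+1 then derived_couple (ss_couple m) else ses_couple.

Definition ss_page (n : nat) := ec_page (ss_couple n).

Definition ss_d (n : nat) : {linear ss_page n -> ss_page n} :=
  @diff R _ (ss_page n).

End SpectralSequence.

Section Multimaps.
Variable R : comPzRingType.

Definition sgn (n : int) : R := (-1) ^+ `|n|%N.

(* [multimap f]: f is a map of dg modules L (x) M_0 (x) ... (x) M_{k-1} -> N;
   [dfwith x u] is the family x with its h-th member replaced by u : M h. *)
Record multimap (L : dgmod R) (k : nat) (M : 'I_k -> dgmod R) (N : dgmod R)
    (f : L -> (forall i, M i) -> N) : Prop := Multimap {
  mm_linl : forall a t t' x, f (a *: t + t') x = a *: f t x + f t' x;
  mm_linr : forall t x h a (u v : M h),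
    f t (dfwith x (a *: u + v)) = a *: f t (dfwith x u) + f t (dfwith x v);
  mm_homog : forall t x p q,
    homog p t -> (forall i, homog (q i) (x i)) ->
    homog (p + \sum_i q i) (f t x);
  mm_diff : forall t x (p : bideg) (q : 'I_k -> bideg),
    homog p t -> (forall i, homog (q i) (x i)) ->
    diff (f t x) = f (diff t) x +
      \sum_(h < k) sgn (p.2 + \sum_(i < k | (i < h)%N) (q i).2) *:
        f t (dfwith x (diff (x h))) }.

Section Theory.
Variables (L : dgmod R) (k : nat) (M : 'I_k -> dgmod R) (N : dgmod R).
Variable f : L -> (forall i, M i) -> N.
Hypothesis Hf : multimap f.

Lemma dfwith_id (x : forall i, M i) h : dfwith x (x h) = x.
Proof. by apply: functional_extensionality_dep => j; case: dfwithP. Qed.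

Lemma dfwith_twice (x : forall i, M i) h (u v : M h) :
  dfwith (dfwith x u) v = dfwith x v.
Proof.
apply: functional_extensionality_dep => j; case: (eqVneq h j) => [<-|hj].
  by rewrite !dfwith_in.
by rewrite !dfwith_out.
Qed.

Lemma mm0l x : f 0 x = 0.
Proof.
have := mm_linl Hf (-1) 0 0 x.
by rewrite scaler0 addr0 scaleN1r addNr.
Qed.
Lemma mm0r t x h : f t (dfwith x (0 : M h)) = 0.
Proof.
have := mm_linr Hf t x (-1) (0 : M h) 0.
by rewrite scaler0 addr0 scaleN1r addNr.
Qed.

Lemma mm_suml I (s : seq I) (F : I -> L) x :
  f (\sum_(a <- s) F a) x = \sum_(a <- s) f (F a) x.
Proof.
elim: s => [|a s IH]; first by rewrite !big_nil mm0l.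
by rewrite !big_cons -[F a]scale1r (mm_linl Hf) IH !scale1r.
Qed.
Lemma mm_sumr I (s : seq I) t x h (F : I -> M h) :
  f t (dfwith x (\sum_(a <- s) F a)) = \sum_(a <- s) f t (dfwith x (F a)).
Proof.
elim: s => [|a s IH]; first by rewrite !big_nil mm0r.
by rewrite !big_cons -[F a]scale1r (mm_linr Hf) IH !scale1r.
Qed.

Lemma multimap_ind (CL : L -> Prop) (CM : forall i, M i -> Prop)
    (Q : N -> Prop) :
  (forall a t, CL t -> CL (proj a t)) ->
  (forall i a x, CM i x -> CM i (proj a x)) ->
  Q 0 -> (forall x y, Q x -> Q y -> Q (x + y)) ->
  (forall t x p q, CL t -> (forall i, CM i (x i)) ->
     homog p t -> (forall i, homog (q i) (x i)) -> Q (f t x)) ->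
  forall t x, CL t -> (forall i, CM i (x i)) -> Q (f t x).
Proof.
move=> CLp CMp Q0 QD Qh t x Ct Cx.
have Qsum I (s : seq I) F : (forall a, Q (F a)) -> Q (\sum_(a <- s) F a).
  by move=> h; elim/big_ind: _.
have [s [_ ->]] := proj_sum t; rewrite mm_suml; apply: (Qsum) => p {s}.
have {Ct} := CLp p _ Ct; have := homog_proj p t.
move: {t}(proj p t) => t ht Ct.
have key (s : seq 'I_k) : forall y : (forall i, M i), (forall i, CM i (y i)) ->
    (forall i, i \notin s -> exists a, homog a (y i)) -> Q (f t y).
  elim: s => [|i s IH] y Cy hy.
    pose q i := projT1 (cid (hy i isT)).
    by apply: (Qh t y p q) => // i; rewrite /q; case: cid.
  rewrite -(dfwith_id y i); have [r [_ ->]] := proj_sum (y i).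
  rewrite mm_sumr; apply: (Qsum) => a; apply: IH => [j|j hj].
    by case: dfwithP => // ; exact: CMp.
  case: (eqVneq i j) => [<-|ij].
    by rewrite dfwith_in; exists a; exact: homog_proj.
  rewrite dfwith_out //; apply: hy; rewrite inE negb_or hj andbT.
  by rewrite eq_sym.
by apply: (key (enum 'I_k)) => // i; rewrite mem_enum.
Qed.

Lemma mm_cycle t x : diff t = 0 -> (forall i, diff (x i) = 0) ->
  diff (f t x) = 0.
Proof.
apply: (multimap_ind (CL := fun t => diff t = 0)
  (CM := fun i x => diff x = 0) (Q := fun y => diff y = 0)).
- by move=> a u hu; rewrite (bidegree_proj (@diff_bideg _ _ _)) hu raddf0.
- by move=> i a u hu; rewrite (bidegree_proj (@diff_bideg _ _ _)) hu raddf0.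
- by rewrite raddf0.
- by move=> u v hu hv; rewrite raddfD /= hu hv addr0.
move=> {}t {}x p q Ct Cx ht hx; rewrite (mm_diff Hf ht hx) Ct mm0l add0r.
by rewrite big1 // => h _; rewrite Cx mm0r scaler0.
Qed.

Definition bnd (b : bideg) (X : diffmod R b) (x : X) := exists y, x = diff y.

Lemma bnd_proj b (X : diffmod R b) a (x : X) : bnd x -> bnd (proj a x).
Proof.
case=> y ->; exists (proj (a - b) y).
by rewrite (bidegree_proj (@diff_bideg _ _ _)) subrK.
Qed.
Lemma bnd0 b (X : diffmod R b) : bnd (0 : X).
Proof. by exists 0; rewrite raddf0. Qed.
Lemma bndD b (X : diffmod R b) (x y : X) : bnd x -> bnd y -> bnd (x + y).
Proof. by case=> u -> [v ->]; exists (u + v); rewrite raddfD. Qed.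

Lemma cycle_projb b (X : diffmod R b) a (x : X) :
  diff x = 0 -> diff (proj a x) = 0.
Proof.
by move=> hu; rewrite (bidegree_proj (@diff_bideg _ _ _)) hu raddf0.
Qed.

Lemma homog_bnd b (X : diffmod R b) a (x : X) : homog a x -> bnd x ->
  exists2 y, homog (a - b) y & x = diff y.
Proof.
move=> hx [y hy]; exists (proj (a - b) y); first exact: homog_proj.
by rewrite (bidegree_proj (@diff_bideg _ _ _)) subrK -hy.
Qed.

Lemma sgnK n : sgn n * sgn n = 1.
Proof. by rewrite /sgn -exprD addnn -mul2n exprM sqrrN expr1n expr1n. Qed.

Lemma mm_bndl t x : bnd t -> (forall i, diff (x i) = 0) -> bnd (f t x).
Proof.
apply: (multimap_ind (CL := @bnd _ _) (CM := fun i x => diff x = 0)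
  (Q := @bnd _ _)).
- by move=> a u; exact: bnd_proj.
- by move=> i a u; exact: cycle_projb.
- exact: bnd0.
- by move=> u v; exact: bndD.
move=> {}t {}x p q Ct Cx ht hx; have [u hu et] := homog_bnd ht Ct.
exists (f u x); rewrite (mm_diff Hf hu hx) -et big1 ?addr0 // => h _.
by rewrite Cx mm0r scaler0.
Qed.

Lemma mm_bndr t x h : diff t = 0 -> bnd (x h) ->
  (forall i, i != h -> diff (x i) = 0) -> bnd (f t x).
Proof.
move=> Ct hb hc.
apply: (multimap_ind (CL := fun t => diff t = 0)
  (CM := fun i u => if i == h then bnd u else diff u = 0)
  (Q := @bnd _ _)) => //.
- by move=> a u; exact: cycle_projb.
- by move=> i a u; case: eqP => _; [exact: bnd_proj | exact: cycle_projb].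
- exact: bnd0.
- by move=> u v; exact: bndD.
- move=> {hb hc Ct}t {}x p q Ct Cx ht hx.
  have := Cx h; rewrite eqxx => /(homog_bnd (hx h)) [y hy exy].
  have hx' i : homog (if i == h then q h - vdeg else q i) (dfwith x y i).
    by case: dfwithP => [|j]; rewrite ?eqxx // eq_sym => /negPf ->.
  have := mm_diff Hf ht hx'; rewrite Ct mm0l add0r (bigD1 h) //=.
  rewrite [X in _ + X]big1; last first.
    move=> i ih; rewrite dfwith_out 1?eq_sym //.
    by have := Cx i; rewrite (negPf ih) => ->; rewrite mm0r scaler0.
  rewrite addr0 dfwith_in -exy dfwith_twice dfwith_id.
  set e := sgn _ => E; exists (e *: f t (dfwith x y)).
  by rewrite linearZ /= E scalerA sgnK scale1r.
move=> i; case: eqVneq => [-> //|]; exact: hc.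
Qed.

Lemma mm_represents_eq t t' x x' (g : homology L)
    (h : forall i, homology (M i)) :
  represents t g -> represents t' g ->
  (forall i, represents (x i) (h i)) -> (forall i, represents (x' i) (h i)) ->
  bnd (f t x - f t' x').
Proof.
move=> rt rt' rx rx'.
have -> : f t x - f t' x' = (f t x - f t' x) + (f t' x - f t' x').
  by rewrite addrA subrK.
apply: bndD.
  have <- : f (t - t') x = f t x - f t' x.
    by rewrite addrC -[- t']scaleN1r (mm_linl Hf) scaleN1r addrC.
  apply: mm_bndl => [|i]; last exact: repr_cycle (rx i).
  exact/(repr_diff rt rt').
have key (s : seq 'I_k) : forall x, (forall i, represents (x i) (h i)) ->
    (forall i, i \notin s -> x i = x' i) -> bnd (f t' x - f t' x').
  elim: s => [|i s IH] y ry hy.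
    have -> : y = x' by apply: functional_extensionality_dep => i; exact: hy.
    by rewrite subrr; exact: bnd0.
  pose z := dfwith y (x' i).
  have -> : f t' y - f t' x' = (f t' y - f t' z) + (f t' z - f t' x').
    by rewrite addrA subrK.
  apply: bndD; last first.
    apply: IH => [j|j hj]; first by rewrite /z; case: dfwithP.
    rewrite /z; case: (eqVneq i j) => [<-|ij]; first by rewrite dfwith_in.
    by rewrite dfwith_out //; apply: hy; rewrite inE negb_or hj eq_sym ij.
  have <- : f t' (dfwith y (y i - x' i)) = f t' y - f t' z.
    rewrite addrC -[- x' i]scaleN1r (mm_linr Hf) dfwith_id scaleN1r addrC.
    by [].
  apply: (@mm_bndr _ _ i); first exact: repr_cycle rt'.
    by rewrite dfwith_in; apply/(repr_diff (ry i) (rx' i)).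
  by move=> j ij; rewrite dfwith_out 1?eq_sym //; exact: repr_cycle (ry j).
by apply: (key (enum 'I_k)) => // i; rewrite mem_enum.
Qed.

Lemma hmulti_ex (g : homology L) (h : forall i, homology (M i)) :
  exists y : homology N, represents (f (hrep g) (fun i => hrep (h i))) y.
Proof.
apply: cycle_repr; apply: mm_cycle => [|i]; exact: repr_cycle (hrepP _).
Qed.

(* [t]([x_1], ..., [x_k]) = [f t (x_1, ..., x_k)], see [hmultiP]. *)
Definition hmulti (g : homology L) (h : forall i, homology (M i)) :
  homology N := projT1 (cid (hmulti_ex g h)).

Lemma hmultiP t x g h : represents t g -> (forall i, represents (x i) (h i)) ->
  represents (f t x) (hmulti g h).
Proof.
move=> rt rx; rewrite /hmulti; case: cid => y hy /=.
have [|y' hy'] := @cycle_repr _ _ N (f t x).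
  by apply: mm_cycle => [|i]; [exact: repr_cycle rt | exact: repr_cycle (rx i)].
suff -> : y = y' by [].
apply/(repr_diff hy hy').
exact: (mm_represents_eq (hrepP g) rt (fun i => hrepP (h i)) rx).
Qed.

Lemma repr_dfwith (x : forall i, M i) (h : forall i, homology (M i)) j
    (u : M j) (v : homology (M j)) :
  (forall i, represents (x i) (h i)) -> represents u v ->
  forall i, represents (dfwith x u i) (dfwith h v i).
Proof.
move=> rx ru i; case: (eqVneq j i) => [<-|ji]; first by rewrite !dfwith_in.
by rewrite !dfwith_out.
Qed.

Notation Hz X := (zero_diffmod vdeg (homology X)).

Lemma hmulti_multimap :
  @multimap (Hz L) k (fun i => Hz (M i)) (Hz N) hmulti.
Proof.
have linl a g g' h :
    hmulti (a *: g + g') h = a *: hmulti g h + hmulti g' h.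
  have rx i := hrepP (h i).
  have rt := hrepP g; have rt' := hrepP g'.
  have H := hmultiP (repr_lin a rt rt') rx.
  apply: (repr_uniq H); rewrite (mm_linl Hf).
  by apply: repr_lin; exact: hmultiP.
have linr g h i a (u v : homology (M i)) : hmulti g (dfwith h (a *: u + v)) =
    a *: hmulti g (dfwith h u) + hmulti g (dfwith h v).
  have rx i := hrepP (h i); have rt := hrepP g.
  have H := hmultiP rt (repr_dfwith rx (repr_lin a (hrepP u) (hrepP v))).
  apply: (repr_uniq H); rewrite (mm_linr Hf).
  by apply: repr_lin; apply: hmultiP => //; apply: repr_dfwith => //;
    exact: hrepP.
have z0l h : hmulti 0 h = 0.
  have := linl (-1) 0 0 h.
  by rewrite scaler0 addr0 scaleN1r addNr.
have z0r g h i : hmulti g (dfwith h (0 : homology (M i))) = 0.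
  have := linr g h i (-1) 0 0.
  by rewrite scaler0 addr0 scaleN1r addNr.
split=> //.
- move=> g h p q /repr_homog [t ht rt] hh.
  pose x i := sval (cid2 (repr_homog (hh i))).
  have hx i : homog (q i) (x i) by rewrite /x; case: cid2.
  have rx i : represents (x i) (h i) by rewrite /x; case: cid2.
  have H := hmultiP rt rx.
  have := repr_proj (p + \sum_i q i) H; rewrite (mm_homog Hf ht hx) => H'.
  exact: repr_uniq H' H.
- move=> g h p q _ _; rewrite /= /zero_map z0l add0r big1 // => i _.
  by rewrite z0r scaler0.
Qed.

End Theory.
End Multimaps.

Section Permutations.
Local Open Scope nat_scope.

(* Indices s : 'I_(\sum_i j i) are in lexicographic correspondence with pairs
   (i, t), t : 'I_(j i), through tagnat.Rank i t, tagnat.sig1, tagnat.sig2. *)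

Lemma block_card k (j : 'I_k -> nat) (s : 'S_k) :
  \sum_a j (s a) = \sum_i j i.
Proof. by rewrite [RHS](reindex_inj (@perm_inj _ s)). Qed.

Definition block_fun k (j : 'I_k -> nat) (s : 'S_k)
    (u : 'I_(\sum_a j (s a))) : 'I_(\sum_a j (s a)) :=
  cast_ord (esym (block_card j s))
    (tagnat.Rank (s (tagnat.sig1 u)) (tagnat.sig2 u)).

Lemma block_fun_inj k (j : 'I_k -> nat) (s : 'S_k) :
  injective (@block_fun k j s).
Proof.
move=> u v /cast_ord_inj /(congr1 val) /eqP; rewrite tagnat.eq_Rank => H.
rewrite -(tagnat.sig2K u) -(tagnat.sig2K v); apply/val_inj/eqP.
by rewrite /= tagnat.eq_Rank -(inj_eq (@perm_inj _ s)).
Qed.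

(* The permutation (a, t) |-> (s a, t) of blocks. *)
Definition block_perm k (j : 'I_k -> nat) (s : 'S_k) :
  'S_(\sum_a j (s a)) := perm (@block_fun_inj k j s).

Definition sum_fun k (j : 'I_k -> nat) (s : forall i, 'S_(j i))
    (u : 'I_(\sum_i j i)) : 'I_(\sum_i j i) :=
  tagnat.Rank (tagnat.sig1 u) (s (tagnat.sig1 u) (tagnat.sig2 u)).

Lemma sum_fun_inj k (j : 'I_k -> nat) (s : forall i, 'S_(j i)) :
  injective (sum_fun s).
Proof.
move=> u v H; rewrite -(tagnat.sig2K u) -(tagnat.sig2K v).
move: H; rewrite /sum_fun.
move: (tagnat.sig1 u) (tagnat.sig2 u) (tagnat.sig1 v) (tagnat.sig2 v).
move=> a x b y /(congr1 val) /eqP.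
rewrite tagnat.eq_Rank => /andP[/eqP e]; case: b / e y => y /eqP /val_inj H.
by congr tagnat.Rank; exact: perm_inj H.
Qed.

(* The direct sum (i, t) |-> (i, s i t). *)
Definition sum_perm k (j : 'I_k -> nat) (s : forall i, 'S_(j i)) :
  'S_(\sum_i j i) := perm (@sum_fun_inj k j s).

End Permutations.

(* Exponent of the Koszul sign of
     (x_0, ..., x_{n-1}) |-> (x_{s 0}, ..., x_{s (n-1)}),
   where a i is the bidegree of x_i; only vertical degrees contribute. *)
Definition perm_exp n (s : 'S_n) (a : 'I_n -> bideg) : int :=
  \sum_(p < n) \sum_(q < n | (p < q)%N && (s q < s p)%N)
    (a (s p)).2 * (a (s q)).2.

(* Exponent of the Koszul sign of the shuffle
     (y_0, ..., y_{k-1}, x_{0,*}, ..., x_{k-1,*})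
       |-> (y_0, x_{0,*}, ..., y_{k-1}, x_{k-1,*}),
   where y_i and x_u have bidegrees a i and b u. *)
Definition shuffle_exp k (j : 'I_k -> nat) (a : 'I_k -> bideg)
    (b : 'I_(\sum_i j i)%N -> bideg) : int :=
  \sum_(i < k) \sum_(u | (tagnat.sig1 u < i)%N) (a i).2 * (b u).2.

(* Equality of elements whose arities are equal but not convertible. *)
Definition arity_eq (P : nat -> Type) m n (x : P m) (y : P n) : Prop :=
  existT P m x = existT P n y.

Section Operads.
Variable R : comPzRingType.

(* The right action is along [(s * t) i = t (s i)], the product of 'S_n; on
   algebras (th . s)(x_i)_i = +- th (x_{s i})_i.  A sequence {P(n)}_{n >= 1} is
   extended by P(0) = 0, which makes all axioms vacuous where an arity is 0. *)
Record operad := Operad {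
  op :> nat -> dgmod R;
  op_reduced : forall x : op 0, x = 0;
  op_act : forall n, 'S_n -> {linear op n -> op n};
  op_unit : op 1;
  op_comp : forall k (j : 'I_k -> nat),
    op k -> (forall i, op (j i)) -> op (\sum_i j i)%N;

  op_act_bideg : forall n (s : 'S_n), has_bidegree 0 (op_act s);
  op_act_diff : forall n (s : 'S_n) x, op_act s (diff x) = diff (op_act s x);
  op_act1 : forall n (x : op n), op_act 1%g x = x;
  op_actM : forall n (s t : 'S_n) x, op_act (s * t)%g x = op_act t (op_act s x);

  op_unit_homog : homog 0 op_unit;
  op_unit_diff : diff op_unit = 0;

  op_comp_multimap : forall k (j : 'I_k -> nat),
    multimap (M := fun i => op (j i)) (op_comp (j := j));

  op_unitl : forall n (x : op n),
    arity_eq (P := op) (op_comp op_unit (fun _ : 'I_1 => x)) x;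
  op_unitr : forall n (x : op n),
    arity_eq (P := op) (op_comp x (fun _ : 'I_n => op_unit)) x;
  op_assoc : forall k (j : 'I_k -> nat) (m : 'I_(\sum_i j i)%N -> nat)
      (th : op k) (ph : forall i, op (j i)) (ps : forall u, op (m u)) a b,
    (forall i, homog (a i) (ph i)) -> (forall u, homog (b u) (ps u)) ->
    arity_eq (P := op)
      (op_comp (op_comp th ph) ps)
      (sgn R (shuffle_exp a b) *:
        op_comp th (fun i => op_comp (ph i) (fun t => ps (tagnat.Rank i t))));
  op_equivl : forall k (j : 'I_k -> nat) (s : 'S_k)
      (th : op k) (ph : forall i, op (j i)) a,
    (forall i, homog (a i) (ph i)) ->
    arity_eq (P := op)
      (op_comp (op_act s th) ph)
      (sgn R (perm_exp s a) *:
        op_act (block_perm j s) (op_comp th (fun i => ph (s i))));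
  op_equivr : forall k (j : 'I_k -> nat) (s : forall i, 'S_(j i))
      (th : op k) (ph : forall i, op (j i)),
    op_comp th (fun i => op_act (s i) (ph i)) =
    op_act (sum_perm s) (op_comp th ph) }.

(* The structure maps are only required to be associative and equivariant
   maps of dg modules; unitality is the separate condition [alg_unital]. *)
Record algebra (P : operad) (A : dgmod R) := Algebra {
  alg :> forall n, P n -> ('I_n -> A) -> A;
  alg_multimap : forall n, multimap (M := fun _ : 'I_n => A) (@alg n);
  alg_equiv : forall n (s : 'S_n) (th : P n) (x : 'I_n -> A) a,
    (forall i, homog (a i) (x i)) ->
    alg (op_act P s th) x =
      sgn R (perm_exp s a) *: alg th (fun i => x (s i));
  alg_assoc : forall k (j : 'I_k -> nat) (th : P k) (ph : forall i, P (j i))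
      (x : 'I_(\sum_i j i)%N -> A) a b,
    (forall i, homog (a i) (ph i)) -> (forall u, homog (b u) (x u)) ->
    alg (op_comp th ph) x =
      sgn R (shuffle_exp a b) *:
        alg th (fun i => alg (ph i) (fun t => x (tagnat.Rank i t))) }.

Definition alg_unital (P : operad) (A : dgmod R) (m : algebra P A) : Prop :=
  forall x, m 1%N (op_unit P) (fun _ => x) = x.

End Operads.
Arguments op_act {R} _ {n}.
Arguments op_comp {R _ k j}.

Section HomologyOperad.
Variables (R : comPzRingType) (P : operad R).

Definition hop (n : nat) : dgmod R := zero_diffmod vdeg (homology (P n)).

Lemma arity_eqP m n (x : P m) (y : P n) : arity_eq (P := op P) x y ->
  forall g h, represents x g -> represents y h -> arity_eq (P := hop) g h.
Proof.
move=> e; have mn : m = n by exact: (congr1 (@projT1 _ _) e).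
case: n / mn y e => y e; have exy : x = y.
  by exact: (Eqdep_dec.inj_pair2_eq_dec nat (@eq_comparable nat) _ _ _ _ e).
move=> g h; rewrite exy => rg rh; congr existT; exact: repr_uniq rg rh.
Qed.

Lemma hop_reduced (x : hop 0) : x = 0.
Proof.
have [u hu] := repr_ex (x : homology (P 0)); apply: (repr_uniq hu).
by rewrite (op_reduced u); apply/repr0P; exists 0; rewrite raddf0.
Qed.

Definition hop_act n (s : 'S_n) : {linear hop n -> hop n} :=
  hmap (@op_act_diff R P n s).

Lemma hop_actP n (s : 'S_n) (x : P n) (h : hop n) :
  represents x h -> represents (op_act P s x) (hop_act s h).
Proof. exact: hmapP. Qed.

Definition hop_unit : hop 1 := projT1 (cid (cycle_repr (@op_unit_diff R P))).

Lemma hop_unitP : represents (op_unit P) hop_unit.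
Proof. by rewrite /hop_unit; case: cid. Qed.

Definition hop_comp k (j : 'I_k -> nat) :
    hop k -> (forall i, hop (j i)) -> hop (\sum_i j i)%N :=
  hmulti (@op_comp_multimap R P k j).

Lemma hop_compP k (j : 'I_k -> nat) (th : P k) (ph : forall i, P (j i))
    (g : hop k) (h : forall i, hop (j i)) :
  represents th g -> (forall i, represents (ph i) (h i)) ->
  represents (op_comp th ph) (hop_comp g h).
Proof. exact: hmultiP. Qed.

Lemma repr_scale n (c : R) (x : P n) (h : hop n) :
  represents x h -> represents (c *: x) (c *: h).
Proof.
move=> hx; have h0 : represents (0 : P n) (0 : hop n).
  by apply/repr0P; exists 0; rewrite raddf0.
by have := repr_lin c hx h0; rewrite !addr0.
Qed.

Lemma repr_family I (n : I -> nat) (a : I -> bideg) (h : forall i, hop (n i)) :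
  (forall i, homog (a i) (h i)) ->
  exists x : forall i, P (n i),
    (forall i, homog (a i) (x i)) /\ (forall i, represents (x i) (h i)).
Proof.
move=> hh; exists (fun i => sval (cid2 (repr_homog (hh i)))).
by split=> i; case: cid2.
Qed.

Lemma hop_act_bideg n (s : 'S_n) : has_bidegree 0 (hop_act s).
Proof. by apply: hmap_bideg; exact: op_act_bideg. Qed.

Lemma hop_act_diff n (s : 'S_n) (x : hop n) :
  hop_act s (diff x) = diff (hop_act s x).
Proof. by rewrite /= /zero_map raddf0. Qed.

Lemma hop_act1 n (x : hop n) : hop_act 1%g x = x.
Proof.
have [u hu] := repr_ex (x : homology (P n)).
by apply: (repr_uniq (hop_actP _ hu)); rewrite op_act1.
Qed.

Lemma hop_actM n (s t : 'S_n) (x : hop n) :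
  hop_act (s * t)%g x = hop_act t (hop_act s x).
Proof.
have [u hu] := repr_ex (x : homology (P n)).
apply: (repr_uniq (hop_actP _ hu)); rewrite op_actM.
by do 2 apply: hop_actP.
Qed.

Lemma hop_unit_homog : homog 0 hop_unit.
Proof.
have := repr_proj 0 hop_unitP; rewrite op_unit_homog => H.
exact: repr_uniq H hop_unitP.
Qed.

Lemma hop_comp_multimap k (j : 'I_k -> nat) :
  multimap (M := fun i => hop (j i)) (hop_comp (j := j)).
Proof. exact: hmulti_multimap. Qed.

Lemma hop_unitl n (x : hop n) :
  arity_eq (P := hop) (hop_comp hop_unit (fun _ : 'I_1 => x)) x.
Proof.
have [u hu] := repr_ex (x : homology (P n)).
apply: (arity_eqP (op_unitl u)) => //.
by apply: hop_compP => //; exact: hop_unitP.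
Qed.

Lemma hop_unitr n (x : hop n) :
  arity_eq (P := hop) (hop_comp x (fun _ : 'I_n => hop_unit)) x.
Proof.
have [u hu] := repr_ex (x : homology (P n)).
apply: (arity_eqP (op_unitr u)) => //.
by apply: hop_compP => // _; exact: hop_unitP.
Qed.

Lemma hop_assoc k (j : 'I_k -> nat) (m : 'I_(\sum_i j i)%N -> nat)
    (th : hop k) (ph : forall i, hop (j i)) (ps : forall u, hop (m u)) a b :
  (forall i, homog (a i) (ph i)) -> (forall u, homog (b u) (ps u)) ->
  arity_eq (P := hop)
    (hop_comp (hop_comp th ph) ps)
    (sgn R (shuffle_exp a b) *:
      hop_comp th (fun i => hop_comp (ph i) (fun t => ps (tagnat.Rank i t)))).
Proof.
move=> hph hps; have [u hu] := repr_ex (th : homology (P k)).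
have [x [hx rx]] := repr_family hph; have [y [hy ry]] := repr_family hps.
apply: (arity_eqP (op_assoc u hx hy)).
  by apply: hop_compP => //; apply: hop_compP.
apply: repr_scale; apply: hop_compP => // i; exact: hop_compP.
Qed.

Lemma hop_equivl k (j : 'I_k -> nat) (s : 'S_k)
    (th : hop k) (ph : forall i, hop (j i)) a :
  (forall i, homog (a i) (ph i)) ->
  arity_eq (P := hop)
    (hop_comp (hop_act s th) ph)
    (sgn R (perm_exp s a) *:
      hop_act (block_perm j s) (hop_comp th (fun i => ph (s i)))).
Proof.
move=> hph; have [u hu] := repr_ex (th : homology (P k)).
have [x [hx rx]] := repr_family hph.
apply: (arity_eqP (op_equivl s u hx)).
  by apply: hop_compP => //; exact: hop_actP.
by apply: repr_scale; apply: hop_actP; apply: hop_compP.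
Qed.

Lemma hop_equivr k (j : 'I_k -> nat) (s : forall i, 'S_(j i))
    (th : hop k) (ph : forall i, hop (j i)) :
  hop_comp th (fun i => hop_act (s i) (ph i)) =
  hop_act (sum_perm s) (hop_comp th ph).
Proof.
have rt := hrepP (th : homology (P k)).
have rx i := hrepP (ph i : homology (P (j i))).
have H := hop_actP (sum_perm s) (hop_compP rt rx).
apply/esym/(repr_uniq H); rewrite -op_equivr.
by apply: hop_compP => // i; exact: hop_actP.
Qed.

Definition homology_operad : operad R :=
  @Operad R hop hop_reduced hop_act hop_unit hop_comp
    hop_act_bideg hop_act_diff hop_act1 hop_actM hop_unit_homog (erefl _)
    hop_comp_multimap hop_unitl hop_unitr hop_assoc hop_equivl hop_equivr.

End HomologyOperad.

(* E^{n+1} as a dg module with zero differential. *)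
Definition ss_term (R : comPzRingType) (A C : dgmod R) (S : short_exact A C)
    (n : nat) : dgmod R := zero_diffmod vdeg (ss_page S n).

(* Main.v *)
Require Import Defs.
From HB Require Import structures.
From mathcomp Require Import all_boot all_order all_algebra all_fingroup.
From mathcomp Require Import boolp.

Set Implicit Arguments.
Unset Strict Implicit.
Unset Printing Implicit Defensive.

Import GRing.Theory.
Local Open Scope ring_scope.

(** Write i and j for the two maps of the short exact sequence.  The proof works
    with elements of A rather than with the successive quotients E^r.  Let
    [page_rep c e] say that c in C, passed through n successive homology
    quotients, names the element e of the page of index n, which is E^{n+1}.
    Unwinding the exact couples gives the classical description of that page as
    a subquotient of C:
      - the elements of C that name something are the j(a) for which
        d a = i^{n+1}(a') has a solution a' ([page_rep_ex], [page_rep_lift]);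
      - the elements that name 0 are the j(b) with i^n(b) a boundary in A
        ([page_rep0], [page_rep_lift]);
      - if j(a) names e, with d a = i^{n+1}(a'), then j(a') names d(e)
        ([page_rep_d]).

    Since i may be moved into and out of any argument of an operation theta
    with d(theta) = 0, the Leibniz rule in A and the equations
    d a_h = i^{n+1}(a'_h) combine ([mult_lift]) into
      d(theta(a_1, ..., a_l))
        = i^{n+1}(sum_h +- theta(a_1, ..., a'_h, ..., a_l)).
    So theta(j a_1, ..., j a_l) = j(theta(a_1, ..., a_l)) names an element of
    the page, and the differential of that element is named by the j-image of
    the sum on the right.  This is the Leibniz rule for d^{(n+1)}.  The same
    computation, with one a_h replaced by a z with d z = i^n(b), or with theta
    replaced by a primitive of it, shows that the element named does not depend
    on the choice of the names ([page_bnd_multr], [page_bnd_multl]).  Hence the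
    operations of C descend to every page, and the axioms of an algebra descend
    with them ([descent_algebra]).  As all pages receive their operations from C
    by the same rule, those on E^{r+1} are induced by those on E^r. *)

(** * Subquotients of a bigraded module *)

Section Subquotients.
Variables (R : comPzRingType) (C E : bigraded R) (rep : C -> E -> Prop).

(** A relation of this kind identifies E with a quotient of a graded submodule of
    C.  Keeping the relation instead of the submodules lets the pages of a
    spectral sequence be treated without nested subtypes. *)
Record subquotient : Prop := Subquotient {
  sq_lin : forall a c e c' e',
    rep c e -> rep c' e' -> rep (a *: c + c') (a *: e + e');
  sq_surj : forall e, exists c, rep c e;
  sq_uniq : forall c e e', rep c e -> rep c e' -> e = e';
  sq_proj : forall a c e, rep c e -> rep (proj a c) (proj a e) }.

Hypothesis Hrep : subquotient.

Lemma sq0 : rep 0 0.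
Proof.
have [c hc] := sq_surj Hrep 0.
by have := sq_lin Hrep (-1) hc hc; rewrite !scaleN1r !addNr.
Qed.

Lemma sqZ a c e : rep c e -> rep (a *: c) (a *: e).
Proof. by move=> hc; have := sq_lin Hrep a hc sq0; rewrite !addr0. Qed.

Lemma sqD c e c' e' : rep c e -> rep c' e' -> rep (c + c') (e + e').
Proof. by move=> ce ce'; have := sq_lin Hrep 1 ce ce'; rewrite !scale1r. Qed.

Lemma sqB c e c' e' : rep c e -> rep c' e' -> rep (c - c') (e - e').
Proof.
by move=> ce ce'; rewrite -!scaleN1r ![_ + -1 *: _]addrC; exact: sq_lin.
Qed.

Lemma sq_sum I (s : seq I) (F : I -> C) (G : I -> E) :
  (forall i, rep (F i) (G i)) -> rep (\sum_(i <- s) F i) (\sum_(i <- s) G i).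
Proof.
by move=> h; elim/big_rec2: _ => [|i c e _]; [exact: sq0 | exact: sqD].
Qed.

Lemma sq_homog a e : homog a e -> exists2 c, homog a c & rep c e.
Proof.
move=> he; have [c hc] := sq_surj Hrep e; exists (proj a c).
  exact: homog_proj.
by rewrite -he; exact: sq_proj.
Qed.

Lemma sq_homog_rep a c e : homog a c -> rep c e -> homog a e.
Proof.
move=> hc ce; have := sq_proj Hrep a ce; rewrite hc => ce'.
exact: (sq_uniq Hrep ce' ce).
Qed.

Lemma sq_family I (e : I -> E) : exists c, forall i, rep (c i) (e i).
Proof. by have [c hc] := choice (fun i => sq_surj Hrep (e i)); exists c. Qed.

Lemma sq_homog_family I (a : I -> bideg) (e : I -> E) :
  (forall i, homog (a i) (e i)) ->
  exists c, (forall i, homog (a i) (c i)) /\ (forall i, rep (c i) (e i)).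
Proof.
move=> he.
have /choice[c hc] i : exists c, homog (a i) c /\ rep c (e i).
  by have [c] := sq_homog (he i); exists c.
by exists c; split=> i; have [] := hc i.
Qed.

Lemma sq_dfwith k (c : 'I_k -> C) (e : 'I_k -> E) h u v :
  (forall i, rep (c i) (e i)) -> rep u v ->
  forall i, rep (dfwith c (i := h) u i) (dfwith e (i := h) v i).
Proof.
move=> hc hu i; case: (eqVneq h i) => [<-|hi]; first by rewrite !dfwith_in.
by rewrite !dfwith_out.
Qed.

End Subquotients.

(** * Descent of an algebra structure to a subquotient *)

Section Descent.
Variables (R : comPzRingType) (P : operad R) (C : dgmod R) (mC : algebra P C).
Variables (E : bigraded R) (rep : C -> E -> Prop).

(** These are the conditions under which the classes of the operad's cycles act
    on the subquotient, independently of the chosen representatives. *)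
Record compatible : Prop := Compatible {
  cp_closed : forall l (th : P l) c e, diff th = 0 ->
    (forall h, rep (c h) (e h)) -> exists y, rep (mC l th c) y;
  cp_zerol : forall l (th : P l) c e, bnd th ->
    (forall h, rep (c h) (e h)) -> rep (mC l th c) 0;
  cp_zeror : forall l (th : P l) c e h, diff th = 0 ->
    (forall g, rep (c g) (e g)) -> e h = 0 -> rep (mC l th c) 0 }.

Hypotheses (Hrep : subquotient rep) (Hc : compatible).

(** Names may be exchanged one at a time, first that of the operation and then
    those of the arguments: by multilinearity each exchange changes the value by
    an operation with one entry that names 0. *)
Lemma descent_indep l (th th' : P l) (g : homology (P l))
    (c c' : 'I_l -> C) e y :
  represents th g -> represents th' g ->
  (forall h, rep (c h) (e h)) -> (forall h, rep (c' h) (e h)) ->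
  rep (mC l th c) y -> rep (mC l th' c') y.
Proof.
move=> rth rth' rc rc'; have mm := alg_multimap mC l.
have swap_th : rep (mC l th c) y -> rep (mC l th' c) y.
  have : rep (mC l (th' - th) c) 0.
    by apply: (cp_zerol Hc (e := e)) => //; apply/(repr_diff rth' rth).
  move=> h0 hy; have := sqD Hrep h0 hy.
  rewrite add0r addrC -{1}[mC l th c]scale1r -(mm_linl mm).
  by rewrite scale1r addrC subrK.
move/swap_th; have th'0 := repr_cycle rth'; clear swap_th rth.
(* [s] lists the positions at which the names may still differ. *)
have key (s : seq 'I_l) : forall c, (forall h, rep (c h) (e h)) ->
    (forall h, h \notin s -> c h = c' h) ->
    rep (mC l th' c) y -> rep (mC l th' c') y.
  elim: s => [|h s IH] d rd hd.
    by have -> : d = c' by apply: funext => h; exact: hd.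
  move=> hy; apply: (IH (dfwith d (i := h) (c' h))).
  - move=> i; case: (eqVneq h i) => [<-|hi]; first by rewrite dfwith_in.
    by rewrite dfwith_out.
  - move=> i si; case: (eqVneq h i) => [<-|hi]; first by rewrite dfwith_in.
    by rewrite dfwith_out //; apply: hd; rewrite inE negb_or eq_sym hi.
  have h0 : rep (mC l th' (dfwith d (i := h) (c' h - d h))) 0.
    apply: (cp_zeror Hc (e := dfwith e (i := h) 0) (h := h)) => //.
      by apply: sq_dfwith => //; rewrite -(subrr (e h)); exact: sqB.
    by rewrite dfwith_in.
  have := mm_linr mm (h := h) th' d 1 (c' h - d h) (d h).
  rewrite !scale1r subrK (dfwith_id (M := fun=> C)) => ->.
  by rewrite -[y]add0r; exact: sqD.
by apply: (key (enum 'I_l)) => // h; rewrite mem_enum.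
Qed.

Lemma descent_ex l (g : homology (P l)) (e : 'I_l -> E) :
  exists y, forall th c, represents th g -> (forall h, rep (c h) (e h)) ->
    rep (mC l th c) y.
Proof.
have [th rth] := repr_ex g; have [c rc] := sq_family Hrep e.
have [y hy] := cp_closed Hc (repr_cycle rth) rc.
by exists y => th' c' rth' rc'; exact: (descent_indep rth rth' rc rc' hy).
Qed.

Notation HP := (homology_operad P).

Definition descent_op l (g : HP l) (e : 'I_l -> E) : E :=
  projT1 (cid (descent_ex (g : homology (P l)) e)).

Lemma descent_opP l (th : P l) (g : HP l) c e :
  represents (M := P l) th g -> (forall h, rep (c h) (e h)) ->
  rep (mC l th c) (descent_op g e).
Proof. by rewrite /descent_op; case: cid => y /= hy; exact: hy. Qed.

Notation EE := (zero_diffmod vdeg E).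

Lemma descent_multimap l :
  multimap (M := fun _ : 'I_l => EE) (N := EE) (@descent_op l).
Proof.
have mm := alg_multimap mC l.
have linl a g g' e : descent_op (a *: g + g' : HP l) e =
    a *: descent_op g e + descent_op g' e.
  have [c rc] := sq_family Hrep e.
  have rt := hrepP (g : homology (P l)).
  have rt' := hrepP (g' : homology (P l)).
  apply: (sq_uniq Hrep (descent_opP (repr_lin a rt rt') rc)).
  by rewrite (mm_linl mm); apply: sq_lin => //; exact: descent_opP.
have linr (g : HP l) (e : 'I_l -> E) h a (u v : E) :
    descent_op g (dfwith e (i := h) (a *: u + v)) =
    a *: descent_op g (dfwith e (i := h) u) +
    descent_op g (dfwith e (i := h) v).
  have [c rc] := sq_family Hrep e; have rt := hrepP (g : homology (P l)).
  have [x rx] := sq_surj Hrep u; have [y ry] := sq_surj Hrep v.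
  have rxy := sq_dfwith h rc (sq_lin Hrep a rx ry).
  apply: (sq_uniq Hrep (descent_opP rt rxy)).
  rewrite (mm_linr mm); apply: sq_lin => //; apply: descent_opP => //;
    exact: sq_dfwith.
split=> //.
- move=> g e p q /repr_homog[th hth rth] /(sq_homog_family Hrep)[c [hc rc]].
  exact: (sq_homog_rep Hrep (mm_homog mm hth hc) (descent_opP rth rc)).
- move=> g e p q _ _; rewrite /= /zero_map.
  have := linl (-1) 0 0 e; rewrite scaler0 addr0 scaleN1r addNr => ->.
  rewrite add0r big1 // => h _; have := linr g e h (-1) 0 0.
  by rewrite scaler0 addr0 scaleN1r addNr => ->; rewrite scaler0.
Qed.

(** The sign depends on the bidegrees of the arguments, hence the choice of names
    of the same bidegrees, here and in [descent_assoc]. *)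
Lemma descent_equiv l (s : 'S_l) (g : HP l) (e : 'I_l -> EE) a :
  (forall i, homog (a i) (e i)) ->
  descent_op (op_act HP s g) e =
  sgn R (perm_exp s a) *: descent_op g (fun i => e (s i)).
Proof.
move=> /(sq_homog_family Hrep)[c [hc rc]].
have [th rth] := repr_ex (g : homology (P l)).
apply: (sq_uniq Hrep (descent_opP (hop_actP s rth) rc)).
rewrite (alg_equiv mC _ _ hc); apply: sqZ => //.
by apply: descent_opP => // i; exact: rc.
Qed.

Lemma descent_assoc k (j : 'I_k -> nat) (g : HP k) (gs : forall i, HP (j i))
    (e : 'I_(\sum_i j i)%N -> EE) a b :
  (forall i, homog (a i) (gs i)) -> (forall u, homog (b u) (e u)) ->
  descent_op (op_comp g gs) e =
  sgn R (shuffle_exp a b) *: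
    descent_op g (fun i => descent_op (gs i) (fun t => e (tagnat.Rank i t))).
Proof.
move=> /repr_family[ph [hph rph]] /(sq_homog_family Hrep)[c [hc rc]].
have [th rth] := repr_ex (g : homology (P k)).
apply: (sq_uniq Hrep (descent_opP (hop_compP rth rph) rc)).
rewrite (alg_assoc mC _ hph hc); apply: sqZ => //.
apply: descent_opP => // i; apply: descent_opP => [|t]; last exact: rc.
exact: rph.
Qed.

Definition descent_algebra : algebra HP EE :=
  @Algebra R HP EE descent_op descent_multimap descent_equiv descent_assoc.

End Descent.

(** * The pages as subquotients of C *)

Section Pages.
Variables (R : comPzRingType) (A C : dgmod R) (S : short_exact A C).
Notation i := (se_i S).
Notation j := (se_j S).

Definition ipow (n : nat) (x : A) : A := iter n i x.
Arguments ipow : simpl never.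

Lemma ipow_is_linear n : linear (ipow n).
Proof.
move=> a x y; elim: n => [|n IH] //.
by rewrite /ipow !iterS -!/(ipow _ _) IH linearP.
Qed.
HB.instance Definition _ n :=
  GRing.isLinear.Build R A A *:%R (ipow n) (ipow_is_linear n).

Lemma ipowS n x : ipow n.+1 x = i (ipow n x).
Proof. by []. Qed.

Lemma ipowSr n x : ipow n.+1 x = ipow n (i x).
Proof. exact: iterSr. Qed.

Lemma ipow_diff n x : ipow n (diff x) = diff (ipow n x).
Proof. by elim: n => [|n IH] //; rewrite !ipowS IH se_i_diff. Qed.

Lemma ipow_proj n a x :
  proj a (ipow n x) = ipow n (proj (a - (1, 0) *+ n) x).
Proof.
elim: n a => [|n IH] a; first by rewrite mulr0n subr0.
rewrite !ipowS -{1}(subrK (1, 0) a) -(bidegree_proj (@se_i_bideg _ _ _ S)) IH.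
by rewrite mulrS opprD addrA.
Qed.

Lemma se_ji0 x : j (i x) = 0.
Proof. by apply/se_exact; exists x. Qed.

Fixpoint page_rep (n : nat) : C -> ss_page S n -> Prop :=
  match n return C -> ss_page S n -> Prop with
  | 0%N => fun c e => represents (M := C) c e
  | m.+1 => fun c e =>
      exists2 e0, page_rep c e0 & represents (M := ss_page S m) e0 e
  end.

Lemma page_rep_subquotient n : subquotient (page_rep (n := n)).
Proof.
elim: n => [|n IH]; split=> /=.
- by move=> *; exact: repr_lin.
- exact: repr_ex.
- exact: repr_uniq.
- by move=> *; exact: repr_proj.
- move=> a c e c' e' [u cu ue] [v cv ve].
  by exists (a *: u + v); [exact: sq_lin | exact: repr_lin].
- move=> e; have [u ue] := repr_ex (e : homology (ss_page S n)).
  have [c cu] := sq_surj IH u.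
  by exists c, u.
- move=> c e e' [u cu ue] [v cv ve].
  by move: ve; rewrite -(sq_uniq IH cu cv) => ve; exact: repr_uniq ue ve.
- move=> a c e [u cu ue].
  by exists (proj a u); [exact: sq_proj | exact: repr_proj].
Qed.

(** D^{n+1} is an iterated subtype of H(A); comparing elements in H(A) avoids the
    nested membership proofs. *)
Fixpoint valD (n : nat) : ec_D (ss_couple S n) -> homology A :=
  match n return ec_D (ss_couple S n) -> homology A with
  | 0%N => fun x => x
  | m.+1 => fun x => valD (val (x : der_D (ss_couple S m)))
  end.

Lemma valD_inj n : injective (@valD n).
Proof. by elim: n => [|n IH] x y // /IH; exact: val_inj. Qed.

Lemma valD_i n x : valD (ec_i x : ec_D (ss_couple S n)) = hi S (valD x).
Proof. by elim: n x => [|n IH] x //=; exact: IH. Qed.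

Lemma valD_surj n x : exists y : ec_D (ss_couple S n),
  valD y = iter n (hi S) x.
Proof.
elim: n => [|n [y hy]]; first by exists x.
have hy' : ec_i y \in im_i (ss_couple S n) by apply/im_iP; exists y.
by exists (der_mk hy'); rewrite /= valD_i hy.
Qed.

(** The map j^{(n+1)} sends i^n [a] to the class named by j(a), because each
    derived j takes a preimage under i and then a homology class. *)
Lemma page_rep_j n a h (y : ec_D (ss_couple S n)) :
  represents a h -> valD y = iter n (hi S) h -> page_rep (j a) (ec_j y).
Proof.
move=> ha; elim: n y => [|n IH] y hy.
  by move: hy => /= ->; exact: hmapP.
have [z hz] := valD_surj n h; exists (ec_j z); first exact: IH.
by apply: der_jP; apply: valD_inj; rewrite valD_i hz.
Qed.

(** All the k^{(r)} are induced by the connecting homomorphism. *)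
Lemma page_rep_k n c (e : ss_page S n) : page_rep c e ->
  exists2 h, represents c h & valD (ec_k e) = conn S h.
Proof.
elim: n e => [|n IH] e /=; first by exists e.
by case=> u /IH[h ch vh] ue; exists h; rewrite // -vh -(der_kP ue).
Qed.

Lemma repr_ipow n x (h : homology A) :
  represents x h -> represents (ipow n x) (iter n (hi S) h).
Proof.
move=> xh; elim: n => [|n IH] //; rewrite ipowS iterS.
exact: hmapP IH.
Qed.

Lemma ipow_inj n : injective (ipow n).
Proof. by elim: n => [|n IH] x y //; rewrite !ipowS => /se_i_inj /IH. Qed.

Lemma lift_cycle n a a' : ipow n a' = diff a -> diff a' = 0.
Proof.
by move=> h; apply: (@ipow_inj n); rewrite ipow_diff h diff_diff raddf0.
Qed.

(** The connecting homomorphism sends the class of j(a) to that of i^n(a'), and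
    j^{(n+1)} removes the n factors i. *)
Lemma page_rep_d n a a' (e : ss_page S n) :
  ipow n.+1 a' = diff a -> page_rep (j a) e -> page_rep (j a') (ss_d S n e).
Proof.
move=> haa' ae; have [h' ha'] := cycle_repr (lift_cycle haa').
have [h ah kh] := page_rep_k ae; apply: (page_rep_j ha'); rewrite kh.
exact: repr_uniq (connP ah haa') (repr_ipow n ha').
Qed.

(** Since i^{n+2}(a') = i^{n+1}(i(a')), the differential of the element that j(a)
    names on one page is named by j(i(a')) = 0, so j(a) survives to the next. *)
Lemma page_rep_ex n a a' : ipow n.+1 a' = diff a ->
  exists e : ss_page S n, page_rep (j a) e.
Proof.
elim: n a' => [|n IH] a' haa'.
  by apply: cycle_repr; rewrite -se_j_diff -haa' ipowS se_ji0.
rewrite ipowSr in haa'; have [u au] := IH _ haa'.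
have [|e ue] := @cycle_repr _ _ (ss_page S n) u; last by exists e, u.
have := page_rep_d haa' au; rewrite se_ji0 => h0.
exact: (sq_uniq (page_rep_subquotient n) h0 (sq0 (page_rep_subquotient n))).
Qed.

(** The two parts are proved together.  A cycle on one page is named by j(a) with
    j(a') naming 0, and the second part corrects a so that a' becomes divisible
    by i.  A boundary is the differential of an element to which the first part
    applies, so its name is j(a') up to a name of 0. *)
Lemma page_rep_lift n :
  (forall c (e : ss_page S n), page_rep c e ->
    exists a a', c = j a /\ ipow n.+1 a' = diff a) /\
  (forall c, page_rep c (0 : ss_page S n) ->
    exists b x, c = j b /\ ipow n b = diff x).
Proof.
elim: n => [|n [IHZ IHB]].
  split=> [c e ce|c /repr0P[c' ->]].
    have [a ac] := se_j_surj S c; have [|a' ha'] := (se_exact S (diff a)).1.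
      by rewrite se_j_diff ac (repr_cycle ce).
    by exists a, a'.
  by have [x <-] := se_j_surj S c'; exists (diff x), x; rewrite se_j_diff.
have sq := page_rep_subquotient n.
split=> [c e [u cu ue]|c [u cu /repr0P[v uv]]].
  have [a [a' [ca haa']]] := IHZ _ _ cu; rewrite ca in cu.
  have := page_rep_d haa' cu; rewrite [ss_d S n u](repr_cycle ue).
  case/IHB => b [x [a'b hb]].
  (* a' = b + i(w) and i^n(b) = d(x), so d(a - i(x)) = i^{n+2}(w). *)
  have [|w hw] := (se_exact S (a' - b)).1; first by rewrite raddfB /= a'b subrr.
  exists (a - i x), w; rewrite ca raddfB /= se_ji0 subr0; split=> //.
  by rewrite ipowSr -hw !raddfB /= -haa' ipowS [ipow _ b]ipowS hb se_i_diff.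
have [c' c'v] := sq_surj sq v.
have [a [a' [ca haa']]] := IHZ _ _ c'v; rewrite ca in c'v.
have := page_rep_d haa' c'v; rewrite /ss_d -uv => ju.
have := sqB sq cu ju; rewrite subrr => /IHB[b [x [cb hb]]].
exists (a' + b), (a + i x); rewrite !raddfD /= haa' ipowS hb se_i_diff.
by rewrite -cb addrC subrK.
Qed.

Lemma page_rep0 n b x : ipow n b = diff x -> page_rep (j b) (0 : ss_page S n).
Proof.
case: n => [|n] hb.
  by rewrite [b]hb; apply/repr0P; exists (j x); rewrite se_j_diff.
have [e xe] := page_rep_ex hb; exists (ss_d S n e); first exact: page_rep_d xe.
by apply/repr0P; exists e.
Qed.

End Pages.

Arguments ipow : simpl never.

(** * The action of the homology operad on the pages *)

Section Multiplicative.
Variables (R : comPzRingType) (P : operad R) (A C : dgmod R).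
Variables (mA : algebra P A) (mC : algebra P C) (S : short_exact A C).
Notation i := (se_i S).
Notation j := (se_j S).
Hypothesis j_mult : forall (l : nat) (th : P l) (x : 'I_l -> A),
  j (mA l th x) = mC l th (fun h => j (x h)).
Hypothesis i_mult : forall (l : nat) (th : P l) (x : 'I_l -> A) (h : 'I_l),
  i (mA l th x) = mA l th (dfwith x (i := h) (i (x h))).

Definition leibniz_sign l (p : bideg) (q : 'I_l -> bideg) (h : 'I_l) : R :=
  sgn R (p.2 + \sum_(g < l | (g < h)%N) (q g).2).

Lemma ipow_mult n l (th : P l) x h y :
  ipow S n (mA l th (dfwith x (i := h) y)) =
  mA l th (dfwith x (i := h) (ipow S n y)).
Proof.
elim: n => [|n IH] //; rewrite !ipowS IH (i_mult _ _ h).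
by rewrite dfwith_in dfwith_twice.
Qed.

(** This is the Leibniz rule in A with the common power of i taken out of the
    sum.  Moving i causes no sign, as i has vertical degree 0. *)
Lemma mult_lift n l (th : P l) x x' p q :
  homog p th -> (forall h, homog (q h) (x h)) ->
  (forall h, ipow S n (x' h) = diff (x h)) ->
  diff (mA l th x) = mA l (diff th) x +
    ipow S n (\sum_h leibniz_sign p q h *: mA l th (dfwith x (i := h) (x' h))).
Proof.
move=> hth hx hx'; rewrite (mm_diff (alg_multimap mA l) hth hx).
congr (_ + _); rewrite linear_sum; apply: eq_bigr => h _.
by rewrite linearZ /= ipow_mult hx'.
Qed.

(** The j-image of [page_cycle n] is the submodule of all names on the page of
    index n, and that of [page_bnd n] is the submodule of the names of 0.  In
    the latter the summand i(w), which j kills, makes room for the terms of the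
    Leibniz rule that are only known to be divisible by i^{n+1}. *)
Definition page_cycle n (x : A) := exists x', ipow S n.+1 x' = diff x.
Definition page_bnd n (y : A) := exists w, bnd (ipow S n (y + i w)).

Lemma page_cycle_proj n a x : page_cycle n x -> page_cycle n (proj a x).
Proof.
case=> x' hx'; exists (proj (a + vdeg - (1, 0) *+ n.+1) x').
by rewrite -ipow_proj hx' (bidegree_proj (@diff_bideg _ _ _)).
Qed.

Lemma bnd_ipow_proj n a (b : A) :
  bnd (ipow S n b) -> bnd (ipow S n (proj a b)).
Proof.
move=> hb; rewrite -[a](addrK ((1, 0) *+ n)) -ipow_proj; exact: bnd_proj.
Qed.

Lemma page_cycle_mult n l (th : P l) x : diff th = 0 ->
  (forall h, page_cycle n (x h)) -> page_cycle n (mA l th x).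
Proof.
have mm := alg_multimap mA l.
apply: (multimap_ind mm (CL := fun t => diff t = 0)
  (CM := fun _ x => page_cycle n x) (Q := page_cycle n)).
- by move=> a t; exact: cycle_projb.
- by move=> _ a y; exact: page_cycle_proj.
- by exists 0; rewrite !raddf0.
- by move=> u v [u' hu] [v' hv]; exists (u' + v'); rewrite !raddfD /= hu hv.
move=> {}th {}x p q th0 /fin_all_exists[x' hx'] hth hx.
exists (\sum_h leibniz_sign p q h *: mA l th (dfwith x (i := h) (x' h))).
by rewrite (mult_lift hth hx hx') th0 (mm0l mm) add0r.
Qed.

Lemma page_bnd0 n : page_bnd n 0.
Proof. by exists 0; rewrite raddf0 addr0 raddf0; exact: bnd0. Qed.

Lemma page_bndD n u v : page_bnd n u -> page_bnd n v -> page_bnd n (u + v).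
Proof.
move=> [w hw] [z hz]; exists (w + z).
by rewrite [i (w + z)]raddfD addrACA raddfD; exact: bndD.
Qed.

(** If th = d(t), then th(x) differs from d(t(x)) by terms divisible by
    i^{n+1}. *)
Lemma page_bnd_multl n l (th : P l) x : bnd th ->
  (forall h, page_cycle n (x h)) -> page_bnd n (mA l th x).
Proof.
have mm := alg_multimap mA l.
apply: (multimap_ind mm (CL := @bnd _ _ _)
  (CM := fun _ x => page_cycle n x) (Q := page_bnd n)).
- by move=> a t; exact: bnd_proj.
- by move=> _ a y; exact: page_cycle_proj.
- exact: page_bnd0.
- exact: page_bndD.
move=> {}th {}x p q thb /fin_all_exists[x' hx'] hth hx.
have [t ht et] := homog_bnd hth thb.
set (w := \sum_h
  leibniz_sign (p - vdeg) q h *: mA l t (dfwith x (i := h) (x' h))).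
exists (ipow S n w), (ipow S n (mA l t x)).
by rewrite -ipow_diff (mult_lift ht hx hx') -et ipowS.
Qed.

(** If i^n(x_h) = d(z), then i^n(th(x)) is up to sign the term of index h in the
    Leibniz rule for th(..., z, ...), all other terms of which are divisible by
    i^{n+1}. *)
Lemma page_bnd_multr n l (th : P l) x h : diff th = 0 -> bnd (ipow S n (x h)) ->
  (forall g, g != h -> page_cycle n (x g)) -> page_bnd n (mA l th x).
Proof.
move=> th0 hb hc; have mm := alg_multimap mA l.
apply: (multimap_ind mm (CL := fun t => diff t = 0)
  (CM := fun g y => if g == h then bnd (ipow S n y) else page_cycle n y)
  (Q := page_bnd n)) => //.
- by move=> a t; exact: cycle_projb.
- move=> g a y.
  by case: eqP => _; [exact: bnd_ipow_proj | exact: page_cycle_proj].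
- exact: page_bnd0.
- exact: page_bndD.
- move=> {th0 hb hc}th {}x p q th0 Cx hth hx.
  have := Cx h; rewrite eqxx => hb.
  have [z hz ez] : exists2 z, homog (q h + (1, 0) *+ n - vdeg) z &
      ipow S n (x h) = diff z.
    apply: homog_bnd => //.
    by rewrite /homog ipow_proj addrK hx.
  have /fin_all_exists[x' hx'] g : exists x', g != h ->
      ipow S n.+1 x' = diff (x g).
    have := Cx g; case: eqP => [_ _|_ [x' hx']]; first by exists 0.
    by exists x'.
  pose y := dfwith x (i := h) z.
  pose r g := if g == h then q h + (1, 0) *+ n - vdeg else q g.
  have hy g : homog (r g) (y g).
    rewrite /y /r; case: (eqVneq g h) => [->|gh]; first by rewrite dfwith_in.
    by rewrite dfwith_out // eq_sym.
  have yh : y h = z by rewrite /y dfwith_in.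
  have yy u : dfwith y (i := h) u = dfwith x (i := h) u.
    exact: (dfwith_twice (M := fun=> A)).
  have := mm_diff mm hth hy; rewrite th0 (mm0l mm) add0r (bigD1 h) //=.
  rewrite -/(leibniz_sign p r h) yh yy -ez -ipow_mult.
  rewrite (dfwith_id (M := fun=> A)).
  set (w := \sum_(g < l | g != h)
    leibniz_sign p r g *: mA l th (dfwith y (i := g) (x' g))).
  have -> : \sum_(g < l | g != h)
      sgn R (p.2 + \sum_(g0 < l | (g0 < g)%N) (r g0).2) *:
      mA l th (dfwith y (i := g) (diff (y g))) = ipow S n.+1 w.
    rewrite linear_sum; apply: eq_bigr => g gh; rewrite linearZ /= ipow_mult.
    by rewrite hx' // /y dfwith_out // eq_sym.
  move=> E.
  exists (leibniz_sign p r h *: w), (leibniz_sign p r h *: mA l th y).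
  rewrite [RHS]linearZ /= E scalerDr scalerA /leibniz_sign sgnK scale1r.
  by rewrite linearD !linearZ /= -ipowSr.
move=> g; case: eqVneq => [-> //|]; exact: hc.
Qed.

Lemma page_rep_bnd n y : page_bnd n y -> page_rep (j y) (0 : ss_page S n).
Proof.
case=> w [x hx]; have := page_rep0 hx.
by rewrite raddfD /= se_ji0 addr0.
Qed.

Lemma page_rep_lift_family n l (c : 'I_l -> C) (e : 'I_l -> ss_page S n) :
  (forall h, page_rep (c h) (e h)) ->
  exists2 a, c = (fun h => j (a h)) & forall h, page_cycle n (a h).
Proof.
move=> ce.
have /fin_all_exists[a ha] h : exists a, c h = j a /\ page_cycle n a.
  have [a [a' [ca haa']]] := (page_rep_lift S n).1 _ _ (ce h).
  by exists a; split=> //; exists a'.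
by exists a => [|h]; [apply: funext => h |]; have [] := ha h.
Qed.

Lemma page_compatible n : compatible mC (@page_rep _ _ _ S n).
Proof.
split=> [l th c e th0|l th c e thb|l th c e h th0] ce.
- have [a -> ha] := page_rep_lift_family ce.
  have [y hy] := page_cycle_mult th0 ha.
  by rewrite -j_mult; exact: page_rep_ex hy.
- have [a -> ha] := page_rep_lift_family ce.
  by rewrite -j_mult; apply: page_rep_bnd; exact: page_bnd_multl.
move=> eh0; have := ce h; rewrite eh0 => /(page_rep_lift S n).2[b [x [cb hb]]].
have [a ca ha] := page_rep_lift_family ce.
have -> : c = (fun g => j (dfwith a (i := h) b g)).
  apply: funext => g; case: (eqVneq h g) => [<-|hg]; first by rewrite dfwith_in.
  by rewrite dfwith_out // ca.
rewrite -j_mult; apply: page_rep_bnd.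
apply: (page_bnd_multr (h := h)) => //; first by rewrite dfwith_in; exists x.
by move=> g hg; rewrite dfwith_out // eq_sym.
Qed.

(** Every page gets its operations directly from C rather than from the preceding
    page, so that no induction on the pages is involved. *)
Definition page_algebra n : algebra (homology_operad P) (ss_term S n) :=
  descent_algebra (page_rep_subquotient S n) (page_compatible n).

Lemma page_algebraP n l (th : P l) (g : homology_operad P l) c
    (e : 'I_l -> ss_page S n) :
  represents (M := P l) th g -> (forall h, page_rep (c h) (e h)) ->
  page_rep (mC l th c) (page_algebra n l g e : ss_page S n).
Proof. exact: descent_opP. Qed.

Lemma page_homog_lift n q (e : ss_page S n) : homog q e ->
  exists a a', [/\ homog q a, page_rep (j a) e & ipow S n.+1 a' = diff a].
Proof.
move=> /(sq_homog (page_rep_subquotient S n))[c hc ce].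
have [a [a' [ca haa']]] := (page_rep_lift S n).1 _ _ ce.
have [|x hx] := @page_cycle_proj n q a; first by exists a'.
exists (proj q a), x; split=> //; first exact: homog_proj.
by rewrite (bidegree_proj (@se_j_bideg _ _ _ S)) addr0 -ca hc.
Qed.

Lemma page_leibniz n l (g : homology_operad P l) (e : 'I_l -> ss_term S n) p q :
  homog p g -> (forall h, homog (q h) (e h)) ->
  ss_d S n (page_algebra n l g e) =
  \sum_h leibniz_sign p q h *:
    page_algebra n l g (dfwith e (i := h) (ss_d S n (e h))).
Proof.
move=> /repr_homog[th hth rth] he.
(* The signs require lifts a_h of the same bidegrees as the e_h. *)
have /fin_all_exists2[a] h : exists2 a, homog (q h) a /\
    page_rep (j a) (e h : ss_page S n) & exists a', ipow S n.+1 a' = diff a.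
  by have [a [a' [*]]] := page_homog_lift (he h); exists a => //; exists a'.
move=> hae /fin_all_exists[a' ha']; have ha h := (hae h).1.
have ae h := (hae h).2; have sq := page_rep_subquotient S n.
have := mult_lift hth ha ha'.
rewrite (repr_cycle rth) (mm0l (alg_multimap mA l)) add0r => /esym lift.
have := page_algebraP rth ae; rewrite -j_mult => /(page_rep_d lift) H.
apply: (sq_uniq sq H); rewrite linear_sum; apply: sq_sum => // h.
rewrite linearZ /= j_mult; apply: sqZ => //.
apply: page_algebraP => // g'; case: (eqVneq h g') => [<-|hg].
  by rewrite !dfwith_in; exact: page_rep_d (ha' h) (ae h).
by rewrite !dfwith_out.
Qed.

End Multiplicative.

Theorem theorem3p1 (R : comPzRingType) (P : operad R) (A C : dgmod R)
    (mA : algebra P A) (mC : algebra P C) (S : short_exact A C)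
    (j_mult : forall (l : nat) (th : P l) (x : 'I_l -> A),
      se_j S (mA l th x) = mC l th (fun h => se_j S (x h)))
    (i_mult : forall (l : nat) (th : P l) (x : 'I_l -> A) (h : 'I_l),
      se_i S (mA l th x) = mA l th (dfwith x (i := h) (se_i S (x h)))) :
  exists m : forall n : nat, algebra (homology_operad P) (ss_term S n),
  [/\ (* on E^1 = H(C), the action induced from C *)
      forall (l : nat) (th : P l) (th' : homology_operad P l)
        (x : 'I_l -> C) (x' : 'I_l -> ss_term S 0),
        represents (M := P l) th th' ->
        (forall h, represents (M := C) (x h) (x' h)) ->
        represents (M := C) (mC l th x) (m 0%N l th' x'),
      (* on E^{r+1} = H(E^r), the action induced from E^r *)
      forall (n l : nat) (th : homology_operad P l)
        (x : 'I_l -> ss_term S n) (x' : 'I_l -> ss_term S n.+1),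
        (forall h, represents (M := ss_page S n) (x h) (x' h)) ->
        represents (M := ss_page S n) (m n l th x) (m n.+1 l th x'),
      (* d^(r) satisfies the Leibniz rule *)
      forall (n l : nat) (th : homology_operad P l) (x : 'I_l -> ss_term S n)
        (p : bideg) (q : 'I_l -> bideg),
        homog p th -> (forall h, homog (q h) (x h)) ->
        ss_d S n (m n l th x) =
        \sum_(h < l) sgn R (p.2 + \sum_(i < l | (i < h)%N) (q i).2) *:
          m n l th (dfwith x (i := h) (ss_d S n (x h)))
    & (* if the action on C is unital, so are all of these *)
      alg_unital mC -> forall n : nat, alg_unital (m n)].
Proof.
exists (page_algebra j_mult i_mult); split.
- move=> l th th' x x' rth rx.
  exact: (page_algebraP j_mult i_mult (n := 0) rth rx).
- move=> n l g x x' rx.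
  have [th rth] := repr_ex (g : homology (P l)).
  have [c rc] := sq_family (page_rep_subquotient S n) x.
  have rc' h : page_rep (c h) (x' h : ss_page S n.+1) by exists (x h).
  have [u cu ue] := page_algebraP j_mult i_mult rth rc'.
  by rewrite (sq_uniq (page_rep_subquotient S n)
    (page_algebraP j_mult i_mult rth rc) cu).
- by move=> n l g x p q; exact: page_leibniz.
move=> unital n x; have sq := page_rep_subquotient S n.
have [c cx] := sq_surj sq x.
have := page_algebraP j_mult i_mult (hop_unitP P) (fun _ => cx).
by rewrite unital => H; exact: (sq_uniq sq H cx).
Qed.
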